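(* For every $k\in\mathbb{N}$, there exist, up to isomorphism, only finitely many non-abelian finite simple groups $S$ with $\gamma(L(S))\leq k$.
   Context: For a finite group $G$, the subgroup graph $L(G)$ is the simple undirected graph whose vertices are the subgroups of $G$, two vertices $H_1,H_2$ being joined by an edge if and only if (up to exchanging them) $H_1<H_2$ and there is no subgroup $K$ of $G$ with $H_1<K<H_2$ (strict inclusions). The genus $\gamma(\Gamma)$ of a finite graph $\Gamma$ is the minimum $g\geq 0$ such that $\Gamma$ can be embedded (drawn with no two edges crossing) in the orientable surface $S_g$ of genus $g$. *)

(* Defs.v *)
From mathcomp Require Import all_boot all_order all_algebra all_fingroup all_solvable.
From mathcomp Require Import all_classical all_reals all_analysis.
Set Implicit Arguments.
Unset Strict Implicit.
Unset Printing Implicit Defensive.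
Import Order.TTheory GRing.Theory Num.Theory.
Import numFieldNormedType.Exports.

Local Open Scope ring_scope.
Local Open Scope classical_set_scope.

(* A finite simple graph is given by a finite vertex type and a symmetric
   irreflexive adjacency relation on it. *)

Definition subgroup_vertex (gT : finGroupType) (G : {group gT}) : finType :=
  {H : {group gT} | H \subset G}.

(* The intermediate group K ranges over all of {group gT}: K < H2 <= G already
   makes it a subgroup of G. *)
Definition covered_by (gT : finGroupType) (H1 H2 : {group gT}) : bool :=
  (H1 \proper H2) &&
  [forall K : {group gT}, ~~ ((H1 \proper K) && (K \proper H2))].

Definition subgroup_graph (gT : finGroupType) (G : {group gT}) :
    rel (subgroup_vertex G) :=
  fun H1 H2 => covered_by (val H1) (val H2) || covered_by (val H2) (val H1).

(* The closed orientable surface of genus g, as a smooth compact surface in R^3.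
   The g unit discs centred at (3 i, 0), i < g, have pairwise disjoint closures
   contained in the open disc of radius 3 g + 1 centred at the origin, so the
   right-hand side below is nonnegative exactly on the closed disc of radius
   3 g + 1 with these g open unit discs removed, and vanishes exactly on the
   boundary circles of that region.  The two sheets z = +- sqrt(...) glued along
   the boundary form the double of a disc with g holes, a surface of genus g
   (the round sphere of radius 1 when g = 0). *)
Definition orientable_surface (R : realType) (g : nat) : set (R * R * R) :=
  [set p | let: (x, y, z) := p in
     z ^+ 2 = ((3 * g + 1)%N%:R ^+ 2 - x ^+ 2 - y ^+ 2) *
       \prod_(i < g) ((x - (3 * i)%N%:R) ^+ 2 + y ^+ 2 - 1)].
Arguments orientable_surface : clear implicits.

(* [arc x y], meaningful on [0, 1] when x and y are adjacent, is the edge xy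
   traversed from x to y; [arc y x] is the same curve traversed backwards. *)
Record is_drawing (R : realType) (V : finType) (e : rel V)
    (M : set (R * R * R)) (pos : V -> R * R * R)
    (arc : V -> V -> R -> R * R * R) : Prop := IsDrawing {
  pos_on : forall x, M (pos x);
  pos_inj : injective pos;
  arc_on : forall x y (t : R), e x y -> 0 <= t <= 1 -> M (arc x y t);
  arc_continuous : forall x y, e x y ->
    {within `[0, 1]%classic, continuous (arc x y)};
  arc_inj : forall x y, e x y -> {in `[0, 1]%R &, injective (arc x y)};
  arc_start : forall x y, e x y -> arc x y 0 = pos x;
  arc_end : forall x y, e x y -> arc x y 1 = pos y;
  arc_rev : forall x y (t : R), e x y -> 0 <= t <= 1 ->
    arc y x t = arc x y (1 - t);
  arc_avoids_vertices : forall x y z (t : R), e x y -> 0 < t < 1 ->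
    arc x y t <> pos z;
  arc_no_crossing : forall x y x' y' (s t : R), e x y -> e x' y' ->
    0 < s < 1 -> 0 < t < 1 -> arc x y s = arc x' y' t ->
    (x = x' /\ y = y') \/ (x = y' /\ y = x')
}.

Definition embeds_in_genus (R : realType) (V : finType) (e : rel V) (g : nat) :
    Prop :=
  exists pos arc, is_drawing e (orientable_surface R g) pos arc.

Definition is_genus (R : realType) (V : finType) (e : rel V) (g : nat) : Prop :=
  embeds_in_genus R e g /\
  (forall h : nat, embeds_in_genus R e h -> (g <= h)%N).

(* Main.v *)
Require Import Defs.
From mathcomp Require Import all_boot all_fingroup all_solvable.
From mathcomp Require Import reals.
From mathcomp Require Import all_order all_algebra.
From mathcomp Require Import ring lra zify.
Set Implicit Arguments.
Unset Strict Implicit.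
Unset Printing Implicit Defensive.

(** Let [S] be a non-abelian finite simple group. Call hinge a subgroup that is
  maximal among the intersections of two distinct maximal subgroups of [S].
  Counting elements shows that some maximal subgroups intersect non-trivially, so
  hinges are non-trivial; the incidence graph between the hinges and the maximal
  subgroups above them has a conjugation-invariant connected component, because
  the stabiliser of a component contains each of its maximal subgroups. A minimal
  invariant connected subgraph [Y] of it has no leaf, and it is not a cycle, since
  a hinge [D] below [M] fixes both [D] and [M]. Hence [Y] contains an orbit [O] of
  vertices of degree at least 3, on which [S] acts faithfully, and
  [#|O| <= 2 * (edges of Y - vertices of Y)].

  Adding to [Y] a bottom vertex joined to the hinges and a top vertex joined to the
  maximal subgroups gives a bipartite minor of the subgroup graph of [S] with
  [#|Y| + 2] vertices and [#|Y| + edges of Y] edges. For a bipartite minor of a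
  surface of bounded genus, Euler's inequality [edges <= 2 * vertices + constant]
  bounds [edges of Y - #|Y|], hence [#|O|] and the order of [S].

  For the inequality, the surface is cut into four rectangular patches, subdivided
  by a fine grid, and the drawing is replaced by the traces of its arcs on the grid.
  A set of edges of the minor that meets the boundary of every face evenly extends
  to a cocycle modulo 2 on the grid; if its periods vanish it is a coboundary, that
  is a cut of the minor. So there are at least [edges - vertices - periods] faces,
  and each of them has at least four sides. *)

(** * Euler's inequality modulo 2 for a bipartite minor of a cell complex *)

Section Euler.
Import GRing.Theory.
Local Open Scope ring_scope.
Local Notation F2 := 'F_2.

Lemma F2_addrr (x : F2) : x + x = 0.
Proof. by rewrite -mulr2n -mulr_natr pchar_Zp // mulr0. Qed.

Lemma F2_oppr (x : F2) : - x = x.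
Proof. by apply/eqP; rewrite -subr_eq0 -opprD F2_addrr oppr0. Qed.

Lemma F2_neq0 (x : F2) : x != 0 -> x = 1.
Proof. by case: x => [[|[|m]] Hm] //= _; apply: val_inj. Qed.

Lemma F2_eqbD (a b : bool) : a%:R + b%:R = (a != b)%:R :> F2.
Proof. by case: a; case: b; rewrite ?F2_addrr ?addr0 ?add0r. Qed.

Lemma F2_addr_eq0 (x y : F2) : x + y = 0 -> x = y.
Proof. by move/eqP; rewrite addr_eq0 F2_oppr => /eqP. Qed.

(** A counting form of rank-nullity: [d u], in practice a difference with [u], embeds the fibre of
    [f] through [u] into the kernel [K]. *)
Lemma leq_card_fibers (U V W : finType) (A : {set U}) (f : U -> V)
    (K : {set W}) (d : U -> U -> W) :
  (forall u, injective (d u)) ->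
  (forall u v, u \in A -> v \in A -> f u = f v -> d u v \in K) ->
  (#|A| <= #|V| * #|K|)%N.
Proof.
move=> d_inj dK.
have -> : #|A| = (\sum_(v : V) #|[set u in A | f u == v]|)%N.
  rewrite -sum1_card (partition_big f predT) //=.
  by apply: eq_bigr => v _; rewrite -sum1_card; apply: eq_bigl => u; rewrite inE.
rewrite -sum_nat_const; apply: leq_sum => v _.
have [->|[u]] := set_0Vmem [set u in A | f u == v]; first by rewrite cards0.
rewrite inE => /andP[uA /eqP fu].
rewrite -(card_imset _ (d_inj u)); apply/subset_leq_card/subsetP => w /imsetP[u'].
by rewrite inE => /andP[u'A /eqP fu'] ->; apply: dK; rewrite ?fu.
Qed.

(** The surface is cut into cells [T] with sides [S]. A dart is a side of a cell, joining the points
    [s d] and [t d], and [opp] glues the sides in pairs; a dart glued to itself is degenerate, its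
    two ends being equal. [L] and [E] are the vertices and the edges of the minor. *)
Variables (T S L E : finType) (U : eqType).
Local Notation D := (T * S)%type.
Variables (opp : D -> D) (s t : D -> U).
Hypothesis oppK : involutive opp.
Hypothesis s_opp : forall d, s (opp d) = s d.
Hypothesis t_opp : forall d, t (opp d) = t d.
Hypothesis opp_loop : forall d, opp d = d -> s d = t d.
Hypothesis cell_boundary : forall (phi : U -> F2) f,
  \sum_i (phi (s (f, i)) + phi (t (f, i))) = 0.

Definition cocycle (y : D -> F2) := [/\ forall d, y (opp d) = y d,
  forall d, s d = t d -> y d = 0 & forall f, \sum_i y (f, i) = 0].

(** The periods separate cohomology classes modulo 2, so [#|I|] bounds the first Betti number. *)
Variables (I : finType) (per : (D -> F2) -> {ffun I -> F2}).
Hypothesis perP : forall y y', cocycle y -> cocycle y' -> per y = per y' ->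
  exists phi : U -> F2, forall d, y d + y' d = phi (s d) + phi (t d).

Variable B : U -> option L.
(** Connectedness of the branch set of [x], in terms of potentials rather than paths. *)
Hypothesis branch_conn : forall (x : L) (phi : U -> F2),
  (forall d, B (s d) = Some x -> B (t d) = Some x -> phi (s d) = phi (t d)) ->
  forall u v, B u = Some x -> B v = Some x -> phi u = phi v.

Variables (src tgt : E -> L) (col : L -> bool).
Hypothesis col_src : forall e, col (src e) = false.
Hypothesis col_tgt : forall e, col (tgt e) = true.
Hypothesis src_tgt_inj : forall e e', src e = src e' -> tgt e = tgt e' -> e = e'.

(** Selects one dart of each glued pair; a dart glued to itself is never selected, but it is
    degenerate. *)
Definition half d := (enum_rank d < enum_rank (opp d))%N.

Lemma half_opp d : half d -> ~~ half (opp d).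
Proof. by rewrite /half oppK -leqNgt => /ltnW. Qed.

Lemma halfVhalf d : s d != t d -> half d || half (opp d).
Proof.
rewrite /half oppK -neq_ltn; apply: contra => /eqP/val_inj/enum_rank_inj dE.
by apply/eqP/opp_loop.
Qed.

Lemma sum_darts (g : D -> F2) : (forall d, s d = t d -> g d = 0) ->
  \sum_d g d = \sum_(d | half d) (g d + g (opp d)).
Proof.
move=> g0; rewrite (bigID half) big_split /=; congr (_ + _).
rewrite (reindex_inj (inv_inj oppK)) /= (bigID half) /=.
rewrite [X in _ + X]big1 ?addr0 => [|d].
  by apply: eq_bigl => d; rewrite andb_idl //; apply: half_opp.
move=> /andP[ho hd]; case: (s d =P t d) => [e|/eqP/halfVhalf].
  by rewrite g0 ?s_opp ?t_opp.
by rewrite (negPf hd) (negPf ho).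
Qed.

Section Half.

Variable dd : E -> D.
Hypothesis dd_half : forall e, half (dd e).
Hypothesis dd_ends : forall e,
  (B (s (dd e)) = Some (src e) /\ B (t (dd e)) = Some (tgt e)) \/
  (B (s (dd e)) = Some (tgt e) /\ B (t (dd e)) = Some (src e)).

Lemma src_tgt e e' : src e <> tgt e'.
Proof. by move=> /(congr1 col); rewrite col_src col_tgt. Qed.

Lemma dd_inj : injective dd.
Proof.
move=> e e' eq_dd.
have [[]|[]] := dd_ends e; have [[]|[]] := dd_ends e'; rewrite eq_dd => -> -> [e1] [e2].
- by apply: src_tgt_inj.
- by case: (@src_tgt e e').
- by case: (@src_tgt e' e).
- by apply: src_tgt_inj.
Qed.

Lemma opp_dd e e' : dd e != opp (dd e').
Proof. by apply: contraL (dd_half e) => /eqP->; apply: half_opp. Qed.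

Definition same_branch d := (B (s d) != None) && (B (s d) == B (t d)).
Definition crossing d := (d \in codom dd) || (opp d \in codom dd).
(** Cells are merged across these sides, which are neither contracted nor edges of the minor. The
    components of the resulting [dual_adj] are the faces, each named by its root cell. *)
Definition rest d := [&& s d != t d, ~~ same_branch d & ~~ crossing d].

Lemma rest_opp d : rest (opp d) = rest d.
Proof. by rewrite /rest /same_branch /crossing oppK s_opp t_opp (orbC (opp d \in _)). Qed.

Lemma dd_rest e : rest (dd e) = false.
Proof. by rewrite /rest /crossing codom_f !andbF. Qed.

Definition dual_adj : rel T := fun f f' => [exists i, rest (f, i) && ((opp (f, i)).1 == f')].

Lemma dual_adj_sym : symmetric dual_adj.
Proof.
suff imp f f' : dual_adj f f' -> dual_adj f' f by move=> f f'; apply/idP/idP; apply: imp.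
case/existsP=> i /andP[ri /eqP <-]; apply/existsP; exists (opp (f, i)).2.
by rewrite -surjective_pairing rest_opp ri oppK /=.
Qed.

Local Notation face := (fingraph.root dual_adj).
Let face_sym := sym_connect_sym dual_adj_sym.

Lemma face_opp d : rest d -> face (opp d).1 = face d.1.
Proof.
move=> rd; apply/esym/(fingraph.rootP face_sym)/connect1/existsP; exists d.2.
by rewrite -surjective_pairing rd eqxx.
Qed.

(* The coefficient of the edge [e] in the boundary of the face [k]. *)
Definition bd (k : T) e : F2 :=
  (face (dd e).1 == k)%:R + (face (opp (dd e)).1 == k)%:R.

(** The coboundary of the indicator of the branch set of [x] sums to zero around each cell, hence
    over all cells of the face [k]. In that sum the [rest] sides cancel in pairs, degenerate sides
    and sides inside a branch set give nothing, and only the edges of the minor survive. *)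
Lemma bd_even k x : \sum_e bd k e * ((src e == x)%:R + (tgt e == x)%:R) = 0.
Proof.
pose phi u : F2 := (B u == Some x)%:R.
pose dphi d := phi (s d) + phi (t d).
have sum0 : \sum_f (face f == k)%:R * \sum_i dphi (f, i) = 0.
  by rewrite big1 // => f _; rewrite cell_boundary mulr0.
rewrite -[RHS]sum0.
under [RHS]eq_bigr => f _ do rewrite mulr_sumr.
rewrite pair_bigA /= [RHS](_ : _ = \sum_d (face d.1 == k)%:R * dphi d); last first.
  by apply: eq_bigr => -[].
rewrite sum_darts => [|d e]; last by rewrite /dphi e F2_addrr mulr0.
have dphiE d : dphi (opp d) = dphi d by rewrite /dphi s_opp t_opp.
under [RHS]eq_bigr => d _ do rewrite dphiE -mulrDl.
have codomE : [set d | half d & d \in codom dd] = [set dd e | e : E].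
  apply/setP => d; rewrite inE; apply/andP/imsetP => [[_ /codomP[e ->]]|[e _ ->]].
    by exists e.
  by rewrite dd_half codom_f.
rewrite (bigID (fun d => d \in codom dd)) /= [X in _ + X]big1 => [|d]; last first.
  move=> /andP[hd ndd]; case: (boolP (rest d)) => [rd|].
    by rewrite face_opp // F2_addrr mul0r.
  rewrite /rest 2!negb_and !negbK /crossing (negPf ndd) /=.
  case/or3P => [/eqP e|sb|/codomP[e e']].
  - by rewrite /dphi e F2_addrr mulr0.
  - by case/andP: sb => _ /eqP e; rewrite /dphi /phi e F2_addrr mulr0.
  - by move: (half_opp hd); rewrite e' dd_half.
rewrite addr0 (eq_bigl (fun d => d \in [set dd e | e : E])); last first.
  by move=> d; rewrite -codomE inE.
rewrite big_imset /=; last by move=> e e' _ _; apply: dd_inj.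
apply: eq_bigr => e _; congr (_ * _); rewrite /dphi /phi.
have sE (y : L) : (Some y == Some x) = (y == x) by [].
by have [[-> ->]|[-> ->]] := dd_ends e; rewrite !sE // addrC.
Qed.

Definition bds k := [set e | bd k e != 0].

(** [w] stands for [src] or [tgt]. By [bd_even] an even number of boundary edges meet the vertex
    [w e], so [e] is not alone there. *)
Lemma bds_other (w : E -> L) k e :
  (forall e', (src e' == w e) || (tgt e' == w e) = (w e' == w e)) ->
  w e = src e \/ w e = tgt e ->
  e \in bds k -> exists2 e', e' \in bds k & e' != e /\ w e' = w e.
Proof.
move=> wE we ek; have := bd_even k (w e).
rewrite (bigD1 e) //= => sum0.
have [/existsP[e' /and3P[? ? /eqP ?]]|nex] :=
  boolP [exists e', [&& e' \in bds k, e' != e & w e' == w e]]; first by exists e'.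
move: sum0; rewrite big1 ?addr0 => [|e' ne].
  move: ek; rewrite inE => /F2_neq0->; rewrite mul1r F2_eqbD.
  have nst : (src e == tgt e) = false by apply/eqP/src_tgt.
  have nts : (tgt e == src e) = false by rewrite eq_sym.
  by case: we => ->; rewrite eqxx ?nst ?nts => /eqP; rewrite oner_eq0.
have [wee|wee] := eqVneq (w e') (w e).
  have : e' \notin bds k.
    apply: contra nex => e'k; apply/existsP; exists e'; apply/and3P; split => //.
    exact/eqP.
  by rewrite inE negbK => /eqP->; rewrite mul0r.
move: (wE e'); rewrite (negPf wee) => /norP[/negPf-> /negPf->].
by rewrite addr0 mulr0.
Qed.

Lemma bds_src k e : e \in bds k ->
  exists2 e', e' \in bds k & e' != e /\ src e' = src e.
Proof.
apply: bds_other; last by left.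
move=> e'; have /eqP/negPf := @src_tgt e e'; rewrite eq_sym => ->; exact: orbF.
Qed.

Lemma bds_tgt k e : e \in bds k ->
  exists2 e', e' \in bds k & e' != e /\ tgt e' = tgt e.
Proof.
by apply: bds_other => [e'|]; [have /eqP/negPf-> := @src_tgt e' e | right].
Qed.

(** Leaving [e0] by its source and by its target gives [e1] and [e2]; leaving [e2] by its source
    gives [e3]. They are distinct because the minor is bipartite without double edges. *)
Lemma bds_card k : bds k != set0 -> (4 <= #|bds k|)%N.
Proof.
case/set0Pn=> e0 e0k.
have [e1 e1k [n10 s10]] := bds_src e0k.
have [e2 e2k [n20 t20]] := bds_tgt e0k.
have [e3 e3k [n32 s32]] := bds_src e2k.
have n_s20 : src e2 <> src e0 by move=> s20; case/eqP: n20; apply: src_tgt_inj.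
have <- : #|[:: e0; e1; e2; e3]| = 4%N.
  apply/card_uniqP; rewrite /= !inE !negb_or (eq_sym e0) n10 (eq_sym e0) n20.
  rewrite (eq_sym e2 e3) n32 /= andbT; apply/andP; split.
    by apply/eqP => e03; apply: n_s20; rewrite -s32 e03.
  apply/andP; split; apply/eqP => e1E; apply: n_s20; last by rewrite -s32 -e1E.
  by rewrite -e1E.
by apply/subset_leq_card/subsetP => e; rewrite !inE => /or4P[] /eqP->;
  move: e0k e1k e2k e3k; rewrite !inE.
Qed.

Definition faces := [set k | bds k != set0].

(** Double counting: a face has at least four boundary edges, and an edge borders at most two
    faces. *)
Lemma leq_faces : (2 * #|faces| <= #|E|)%N.
Proof.
rewrite -(@leq_pmul2l 2) // mulnA -sum1_card big_distrr /=.
apply: (@leq_trans (\sum_(k in faces) #|bds k|)%N).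
  by apply: leq_sum => k; rewrite inE muln1; apply: bds_card.
apply: (@leq_trans (\sum_k #|bds k|)%N).
  by rewrite [leqRHS](bigID (fun k => k \in faces)) leq_addr.
under eq_bigr => k _ do rewrite -sum1_card big_mkcond.
rewrite exchange_big /= -[#|E|]sum1_card big_distrr /=; apply: leq_sum => e _.
rewrite -big_mkcond sum1_card muln1.
apply: (@leq_trans #|[set face (dd e).1; face (opp (dd e)).1]|); last by rewrite cards2; case: eqP.
apply/subset_leq_card/subsetP => k.
rewrite -[k \in _]/(e \in bds k) !inE /bd F2_eqbD !(eq_sym k).
by case: (_ == k); case: (_ == k); rewrite //= ?eqxx.
Qed.

Definition null_edges := [set y : {ffun E -> F2} |
  [forall k in faces, \sum_e bd k e * y e == 0]].

Lemma null_edgesP (y : {ffun E -> F2}) k :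
  y \in null_edges -> \sum_e bd k e * y e = 0.
Proof.
rewrite inE => /forall_inP y0; case: (boolP (k \in faces)) => [/y0/eqP //|].
rewrite inE negbK => /eqP/setP bds0; rewrite big1 // => e _.
by move: (bds0 e); rewrite !inE => /negbFE/eqP->; rewrite mul0r.
Qed.

Lemma leq_null_edges : (2 ^ #|E| <= 2 ^ #|faces| * #|null_edges|)%N.
Proof.
pose f (y : {ffun E -> F2}) := [ffun k : {k | k \in faces} => \sum_e bd (val k) e * y e].
have -> : (2 ^ #|E| = #|[set: {ffun E -> F2}]|)%N by rewrite cardsT card_ffun card_ord.
have -> : (2 ^ #|faces| = #|{ffun {k | k \in faces} -> F2}|)%N.
  by rewrite card_ffun card_ord card_sig.
apply: (leq_card_fibers (d := fun u v => v - u) (f := f)).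
  by move=> u v w; apply: addIr.
move=> u v _ _ fuv; rewrite inE; apply/forall_inP => k kf.
have /ffunP/(_ (Sub k kf)) := fuv; rewrite !ffunE /= => e.
under eq_bigr => i _ do rewrite !ffunE mulrDr mulrN.
by rewrite big_split /= sumrN e subrr.
Qed.

Lemma sum_side_eq (f : T) (d : D) : \sum_i ((f, i) == d)%:R = (f == d.1)%:R :> F2.
Proof.
have [->|ne] := eqVneq f d.1.
  rewrite (bigD1 d.2) //= -surjective_pairing eqxx big1 ?addr0 // => i ni.
  by case: eqP => // dE; rewrite -dE eqxx in ni.
by rewrite big1 // => i _; case: eqP => // dE; rewrite -dE eqxx in ne.
Qed.

(** A dual path carries a defect from the cell [f] to the cell [f']: each side that it crosses, with
    its mate, receives 1, and crossings add up modulo 2. *)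
Lemma face_chain f f' : connect dual_adj f f' -> exists w : D -> F2,
  [/\ forall d, ~~ rest d -> w d = 0, forall d, w (opp d) = w d &
      forall g, \sum_i w (g, i) = (g == f)%:R + (g == f')%:R].
Proof.
case/connectP=> p; elim: p f => [|f1 p IHp] f /=.
  by move=> _ ->; exists (fun _ => 0); split => // g; rewrite big1 ?F2_addrr.
case/andP=> /existsP[i0 /andP[r0 /eqP o0]] /IHp{}IHp /IHp[w [wr wo wb]].
pose d0 := (f, i0); exists (fun d => (d == d0)%:R + (d == opp d0)%:R + w d).
split=> [d nrd|d|g].
- rewrite wr // addr0; have [dE|_] := eqVneq d d0; first by rewrite dE r0 in nrd.
  have [dE|_] := eqVneq d (opp d0); last by rewrite addr0.
  by rewrite dE rest_opp r0 in nrd.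
- rewrite wo (inj_eq (inv_inj oppK)) -(inj_eq (inv_inj oppK) (opp d)) oppK.
  by rewrite (addrC (d == _)%:R).
rewrite !big_split /= !sum_side_eq wb o0 -!addrA; congr (_ + _).
by rewrite addrA F2_addrr add0r.
Qed.

(** Placing [y] on the chosen darts and their mates leaves a defect [q f] at each cell [f]. The
    chain [w f] moves it to the root of the face, where the total is the sum of [y] over the face
    boundary, that is 0. *)
Lemma null_edges_extend (y : {ffun E -> F2}) : y \in null_edges ->
  exists z : D -> F2, [/\ cocycle z, forall e, z (dd e) = y e &
    forall d, same_branch d -> z d = 0].
Proof.
move=> y0.
have /fin_all_exists[w wP] f : exists w : D -> F2,
    [/\ forall d, ~~ rest d -> w d = 0, forall d, w (opp d) = w d &
      forall g, \sum_i w (g, i) = (g == f)%:R + (g == face f)%:R].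
  by apply: face_chain; apply: connect_root.
pose q f : F2 := \sum_e y e * ((f == (dd e).1)%:R + (f == (opp (dd e)).1)%:R).
pose a d : F2 := \sum_e y e * ((d == dd e)%:R + (d == opp (dd e))%:R).
have a_opp d : a (opp d) = a d.
  apply: eq_bigr => e _; rewrite (inj_eq (inv_inj oppK)) addrC.
  by rewrite -(inj_eq (inv_inj oppK) (opp d)) oppK.
have a0 d : crossing d = false -> a d = 0.
  move=> /norP[nd nod]; apply: big1 => e _.
  have -> : (d == dd e) = false by apply: contraNF nd => /eqP->; apply: codom_f.
  have -> : (d == opp (dd e)) = false.
    by apply: contraNF nod => /eqP->; rewrite oppK codom_f.
  by rewrite addr0 mulr0.
have ncross d : s d = t d \/ same_branch d -> crossing d = false.
  have ends e : s (dd e) <> t (dd e) /\ B (s (dd e)) <> B (t (dd e)).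
    have nst : B (s (dd e)) <> B (t (dd e)).
      have [[-> ->]|[-> ->]] := dd_ends e; first by case=> /src_tgt.
      by case=> /esym /src_tgt.
    by split=> // st; rewrite st in nst.
  move=> H; apply/negP => /orP[] /codomP[e dE].
    by case: (ends e) => ? ?; case: H; rewrite dE // => /andP[_ /eqP].
  have {}dE : d = opp (dd e) by rewrite -dE oppK.
  case: (ends e) => ? ?; case: H; rewrite dE /same_branch s_opp t_opp //.
  by case/andP => _ /eqP.
exists (fun d => a d + \sum_f q f * w f d); split.
- split=> [d|d st|f].
  + by rewrite a_opp; congr (_ + _); apply: eq_bigr => f _; have [_ -> _] := wP f.
  + rewrite a0 ?add0r; last by apply: ncross; left.
    by rewrite big1 // => f _; have [w0 _ _] := wP f; rewrite w0 ?mulr0 // /rest st eqxx.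
  rewrite big_split /=.
  have -> : \sum_i a (f, i) = q f.
    rewrite exchange_big; apply: eq_bigr => e _ /=.
    by rewrite -mulr_sumr big_split /= !sum_side_eq.
  rewrite exchange_big /=.
  rewrite [X in _ + X](_ : _ = q f + \sum_g q g * (f == face g)%:R); last first.
    under eq_bigr => g _.
      rewrite -mulr_sumr; have [_ _ ->] := wP g; rewrite mulrDr; over.
    rewrite big_split /=; congr (_ + _).
    rewrite (bigD1 f) //= eqxx mulr1 big1 ?addr0 // => g.
    by rewrite eq_sym => /negPf->; rewrite mulr0.
  rewrite addrA F2_addrr add0r -[RHS](null_edgesP f y0) /q.
  under eq_bigr => g _ do rewrite mulr_suml.
  rewrite exchange_big /=; apply: eq_bigr => e _.
  under eq_bigr => g _ do rewrite -mulrA.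
  rewrite -mulr_sumr mulrC; congr (_ * _); rewrite /bd.
  under eq_bigr => g _ do rewrite mulrDl.
  rewrite big_split /= !(eq_sym _ f); congr (_ + _).
    by rewrite (bigD1 (dd e).1) //= eqxx mul1r big1 ?addr0 // => g /negPf->; rewrite mul0r.
  by rewrite (bigD1 (opp (dd e)).1) //= eqxx mul1r big1 ?addr0 // => g /negPf->; rewrite mul0r.
- move=> e; rewrite [X in _ + X]big1 ?addr0 => [|f _]; last first.
    by have [w0 _ _] := wP f; rewrite w0 ?mulr0 // dd_rest.
  rewrite /a (bigD1 e) //= eqxx (negPf (opp_dd _ _)) addr0 mulr1 big1 ?addr0 // => e' ne.
  by rewrite (inj_eq dd_inj) eq_sym (negPf ne) (negPf (opp_dd _ _)) addr0 mulr0.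
move=> d sd; rewrite a0 ?add0r; last by apply: ncross; right.
by rewrite big1 // => f _; have [w0 _ _] := wP f; rewrite w0 ?mulr0 // /rest sd /= andbF.
Qed.

Hypothesis branch_dec : forall x : L, (exists u, B u = Some x) \/ (forall u, B u <> Some x).

(** If two elements extend to cocycles with equal periods, the extensions differ by a coboundary.
    Both vanish inside branch sets, so the potential is constant on each of them and the difference
    is a cut of the minor; there are at most [2 ^ #|L|] cuts. *)
Lemma card_null_edges : (#|null_edges| <= 2 ^ #|I| * 2 ^ #|L|)%N.
Proof.
have /fin_all_exists[z zP] (y : {ffun E -> F2}) : exists z : D -> F2, y \in null_edges ->
    [/\ cocycle z, forall e, z (dd e) = y e & forall d, same_branch d -> z d = 0].
  have [/null_edges_extend[z ?]|ny] := boolP (y \in null_edges); first by exists z.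
  by exists (fun _ => 0).
pose delta (phi : {ffun L -> F2}) := [ffun e => phi (src e) + phi (tgt e)] : {ffun E -> F2}.
have cardI : (#|[set delta phi | phi in [set: {ffun L -> F2}]]| <= 2 ^ #|L|)%N.
  by apply: (leq_trans (leq_imset_card _ _)); rewrite cardsT card_ffun card_ord.
apply: leq_trans (leq_mul (leqnn _) cardI).
have -> : (2 ^ #|I| = #|{ffun I -> F2}|)%N by rewrite card_ffun card_ord.
apply: (leq_card_fibers (d := fun u v => u + v) (f := fun y => per (z y))).
  by move=> u v w; apply: addrI.
move=> u v /zP[zu uE u0] /zP[zv vE v0] /(perP zu zv)[phi phiE].
have /fin_all_exists[psi psiP] (x : L) : exists c : F2, forall w, B w = Some x -> phi w = c.
  case: (branch_dec x) => [[w Bw]|nB]; last by exists 0 => w /nB.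
  exists (phi w) => w' Bw'; apply: (@branch_conn x) => // d sx tx.
  have sd : same_branch d by rewrite /same_branch sx tx eqxx.
  by apply/F2_addr_eq0; rewrite -phiE u0 // v0 // addr0.
apply/imsetP; exists [ffun x => psi x]; first by rewrite inE.
apply/ffunP => e; rewrite !ffunE -uE -vE phiE.
by have [[/psiP-> /psiP->]|[/psiP-> /psiP->]] := dd_ends e; rewrite // addrC.
Qed.

(** Combines [#|E| <= #|faces| + #|I| + #|L|], taken twice, with [2 * #|faces| <= #|E|]. *)
Lemma half_euler_bound : (#|E| <= 2 * #|L| + 2 * #|I|)%N.
Proof.
have := leq_trans leq_null_edges (leq_mul (leqnn _) card_null_edges).
rewrite -!expnD leq_exp2l // => le1; have := leq_faces.
move: #|faces| #|E| #|L| #|I| le1 => F e l h le1 le2.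
rewrite -(leq_add2r e) addnn -mul2n -mulnDr (leq_trans (leq_mul (leqnn 2) le1)) //.
by rewrite !mulnDr addnC leq_add // addnC.
Qed.

End Half.

Lemma euler_bound (branch_dec : forall x : L, (exists u, B u = Some x) \/ (forall u, B u <> Some x)) :
  (forall e, exists d,
    (B (s d) = Some (src e) /\ B (t d) = Some (tgt e)) \/
    (B (s d) = Some (tgt e) /\ B (t d) = Some (src e))) ->
  (#|E| <= 2 * #|L| + 2 * #|I|)%N.
Proof.
move=> ends.
have /fin_all_exists2[dd dd_half dd_ends] e : exists2 d, half d &
    (B (s d) = Some (src e) /\ B (t d) = Some (tgt e)) \/
    (B (s d) = Some (tgt e) /\ B (t d) = Some (src e)).
  have [d dE] := ends e.
  have /halfVhalf/orP[hd|hd] : s d != t d; first last.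
  - by exists (opp d); rewrite ?s_opp ?t_opp.
  - by exists d.
  apply/eqP => st; case: dE; rewrite st => -[-> []]; first exact: (@src_tgt e e).
  by move/esym; exact: (@src_tgt e e).
exact: (half_euler_bound dd_half dd_ends).
Qed.

End Euler.

(** * Four rectangular charts covering the surface *)

Section Profile.
Import Order.TTheory GRing.Theory Num.Theory.
Local Open Scope ring_scope.
Variables (R : rcfType) (g : nat).
Implicit Types (x v y : R) (s t : bool).

Definition rad : R := (3 * g + 1)%:R.
Definition cap (k : nat) x : R := 1 - (x - (3 * k)%:R) ^+ 2.
(** Outside the hole [k], [y ^ 2] is at least [cap k x]. As the holes are apart, at most one summand
    is positive, and over [x] the surface is the region where [y ^ 2] lies between [floor x] and
    [floor x + height x]. *)
Definition floor x : R := \sum_(k < g) Num.max 0 (cap k x).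
Definition height x : R := rad ^+ 2 - x ^+ 2 - floor x.
Definition wall x y : R :=
  (rad ^+ 2 - x ^+ 2 - y) * \prod_(i < g) ((x - (3 * i)%:R) ^+ 2 + y - 1).
Definition in_hole x := exists2 k, (k < g)%N & 0 <= cap k x.

Lemma radE : rad = 3 * g%:R + 1.
Proof. by rewrite /rad natrD natrM. Qed.

Lemma cap_le_floor k x : (k < g)%N -> cap k x <= floor x.
Proof.
move=> kg; rewrite /floor (bigD1 (Ordinal kg)) //= -[leLHS]addr0 lerD //.
  by rewrite le_max lexx orbT.
by apply: sumr_ge0 => i _; rewrite le_max lexx.
Qed.

Lemma floor_ge0 x : 0 <= floor x.
Proof. by apply: sumr_ge0 => i _; rewrite le_max lexx. Qed.

Lemma cap_ge0P k x : reflect ((3 * k)%:R - 1 <= x <= (3 * k)%:R + 1) (0 <= cap k x).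
Proof.
rewrite /cap; move: (3 * k)%:R => c; apply: (iffP idP) => [h|/andP[h1 h2]]; last by nra.
by apply/andP; split; nra.
Qed.

Lemma cap_gt0P k x : reflect ((3 * k)%:R - 1 < x < (3 * k)%:R + 1) (0 < cap k x).
Proof.
rewrite /cap; move: (3 * k)%:R => c; apply: (iffP idP) => [h|/andP[h1 h2]]; last by nra.
by apply/andP; split; nra.
Qed.

Lemma holes_apart k k' x : (k < k')%N -> 0 <= cap k x -> cap k' x < -1.
Proof.
move=> kk /cap_ge0P/andP[h1 h2]; rewrite /cap.
have : (3 * k)%:R + 3 <= (3 * k')%:R :> R by rewrite -natrD ler_nat; lia.
by move: h1 h2; move: (3 * k)%:R (3 * k')%:R => c c' h1 h2 h; nra.
Qed.

Lemma holes_apart' k k' x : k != k' -> 0 <= cap k x -> cap k' x < -1.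
Proof.
case: (ltngtP k k') => // kk _; first exact: holes_apart.
move=> /cap_ge0P/andP[h1 h2]; rewrite /cap.
have : (3 * k')%:R + 3 <= (3 * k)%:R :> R by rewrite -natrD ler_nat; lia.
by move: h1 h2; move: (3 * k)%:R (3 * k')%:R => c c' h1 h2 h; nra.
Qed.

Lemma floor_in_hole k x : (k < g)%N -> 0 <= cap k x -> floor x = cap k x.
Proof.
move=> kg c0; rewrite /floor (bigD1 (Ordinal kg)) //= big1 ?addr0.
  by apply/max_idPr.
move=> i ne; apply/max_idPl.
have : k != i by rewrite eq_sym; apply: contra ne => /eqP e; apply/eqP/val_inj.
by move/holes_apart' => /(_ x c0); lra.
Qed.

Lemma floor_cases x : floor x = 0 \/ exists2 k, (k < g)%N & 0 < cap k x /\ floor x = cap k x.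
Proof.
have [/existsP[k ck]|nk] := boolP [exists k : 'I_g, 0 < cap k x].
  by right; exists k => //; split=> //; apply: floor_in_hole => //; apply: ltW.
left; apply: big1 => k _; apply/max_idPl; rewrite leNgt.
by apply: contra nk => ck; apply/existsP; exists k.
Qed.

Lemma hole_height k x : (k < g)%N -> 0 <= cap k x -> 0 < rad ^+ 2 - x ^+ 2 - 1.
Proof.
move=> kg /cap_ge0P/andP[h1 h2]; rewrite radE.
have h3 : (3 * k)%:R + 3 <= 3 * g%:R :> R by rewrite -natrM -natrD ler_nat; lia.
have h4 : 0 <= (3 * k)%:R :> R by [].
by move: h1 h2 h3 h4; move: (3 * k)%:R g%:R => c G h1 h2 h3 h4; nra.
Qed.

Lemma height_gt0 x : - rad < x < rad -> 0 < height x.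
Proof.
move=> /andP[h1 h2]; rewrite /height; have [->|[k kg [c0 ->]]] := floor_cases x.
  by nra.
have := hole_height kg (ltW c0); rewrite /cap; have := sqr_ge0 (x - (3 * k)%:R); lra.
Qed.

Lemma rim x : x ^+ 2 = rad ^+ 2 -> floor x = 0 /\ height x = 0.
Proof.
move=> e; rewrite /height; have [->|[k kg [c0 _]]] := floor_cases x; first by split=> //; rewrite e; lra.
by have := hole_height kg (ltW c0); rewrite e; lra.
Qed.

Lemma rim_or x : - rad <= x <= rad -> x ^+ 2 = rad ^+ 2 \/ 0 < height x.
Proof.
case/andP; rewrite le_eqVlt => /orP[/eqP <-|h1]; first by left; rewrite sqrrN.
rewrite le_eqVlt => /orP[/eqP ->|h2]; first by left.
by right; apply: height_gt0; rewrite h1.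
Qed.

Lemma height_ge0 x : - rad <= x <= rad -> 0 <= height x.
Proof. by case/rim_or => [/rim[_ ->]|/ltW]. Qed.

Definition signed s x := if s then x else - x.
(** As [v] runs from 0 to 1, [y ^ 2] runs linearly from its inner bound to the outer circle; in
    [chart], [s] and [t] choose the signs of the last two coordinates. *)
Definition level x v := floor x + v * height x.
Definition chart s t x v : R * R * R :=
  (x, signed s (Num.sqrt (level x v)), signed t (Num.sqrt (wall x (level x v)))).

Lemma wall_ge0 x v : - rad <= x <= rad -> 0 <= v <= 1 -> 0 <= wall x (level x v).
Proof.
move=> hx /andP[v0 v1]; have h0 := height_ge0 hx; apply: mulr_ge0.
  by rewrite /level; move: h0; rewrite /height; nra.
apply: prodr_ge0 => i _; have := cap_le_floor x (ltn_ord i); rewrite /cap /level.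
by have := mulr_ge0 v0 h0; lra.
Qed.

Lemma level_ge0 x v : - rad <= x <= rad -> 0 <= v <= 1 -> 0 <= level x v.
Proof.
by move=> hx /andP[v0 _]; rewrite addr_ge0 ?floor_ge0 // mulr_ge0 // height_ge0.
Qed.

Lemma signed_sqrt_inj s s' x y : 0 <= x -> 0 <= y ->
  signed s (Num.sqrt x) = signed s' (Num.sqrt y) -> x = y /\ (s = s' \/ x = 0).
Proof.
move=> x0 y0 e.
have sq (a : R) : 0 <= a -> Num.sqrt a ^+ 2 = a by apply: sqr_sqrtr.
have xy : x = y.
  have := congr1 (fun a => a ^+ 2) e.
  by rewrite /signed; case: (s) (s') => -[]; rewrite ?sqrrN !sq.
split=> //; subst y; case: (eqVneq s s') => [->|ne]; [by left|right].
have : Num.sqrt x = 0 by case: s s' e ne => -[] //= e _; lra.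
by move=> s0; rewrite -(sq x) // s0 expr0n.
Qed.

(** The gluing pattern of the charts, read off from the vanishing of the square roots. The side
    [v = 1] is shared by both values of [t]; the side [v = 0] by both values of [t] over a hole and
    of [s] over a gap; at each end of the range of [x] all charts collapse to one point. *)
Lemma chart_inj s t x v s' t' x' v' :
  - rad <= x <= rad -> 0 <= v <= 1 -> 0 <= v' <= 1 ->
  chart s t x v = chart s' t' x' v' ->
  x = x' /\ (x ^+ 2 = rad ^+ 2 \/ [/\ v = v', s = s' \/ (v = 0 /\ floor x = 0) &
     [\/ t = t', v = 1 | v = 0 /\ in_hole x]]).
Proof.
move=> hx hv hv' [<- e1 e2]; split=> //.
have [|h0] := rim_or hx; [by left|right].
have [eY sS] := signed_sqrt_inj (level_ge0 hx hv) (level_ge0 hx hv') e1.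
have eV : v = v'.
  by move: eY => /addrI/mulIf; apply; apply: lt0r_neq0.
rewrite -eY in e2; split=> //.
  case: sS => [|Y0]; [by left|right].
  have f0 := floor_ge0 x; have [v0 v1] := andP hv.
  have m0 : 0 <= v * height x by rewrite mulr_ge0 // ltW.
  have /eqP : v * height x = 0 by move: Y0; rewrite /level; lra.
  rewrite mulf_eq0 (gt_eqF h0) orbF => /eqP ->; split=> //.
  by move: Y0; rewrite /level; lra.
have [_ [->|/eqP]] := signed_sqrt_inj (wall_ge0 hx hv) (wall_ge0 hx hv) e2; first by constructor 1.
have [v0 v1] := andP hv.
rewrite mulf_eq0 => /orP[/eqP z|/prodf_eq0[i _ /eqP z]].
  constructor 2.
  have /eqP : (1 - v) * height x = 0 by rewrite mulrBl mul1r {1}/height; move: z; rewrite /level; lra.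
  by rewrite mulf_eq0 (gt_eqF h0) orbF subr_eq0 => /eqP.
constructor 3.
have m0 : 0 <= v * height x by rewrite mulr_ge0 // ltW.
have cE : cap i x = level x v by rewrite /cap; lra.
have le := cap_le_floor x (ltn_ord i).
have /eqP : v * height x = 0 by move: le; rewrite cE /level; lra.
rewrite mulf_eq0 (gt_eqF h0) orbF => /eqP; split=> //; exists i => //.
by rewrite cE level_ge0.
Qed.

Lemma chart_rim s t s' t' x v v' : x ^+ 2 = rad ^+ 2 -> chart s t x v = chart s' t' x v'.
Proof.
move=> e; have [f0 h0] := rim e; rewrite /chart /level f0 h0 !mulr0 /wall e !subrr addr0 subr0 mul0r sqrtr0.
by rewrite /signed oppr0 !if_same.
Qed.

Lemma chart_top s t t' x : chart s t x 1 = chart s t' x 1.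
Proof.
rewrite /chart (_ : wall x _ = 0) ?sqrtr0; first by rewrite /signed oppr0 !if_same.
by rewrite /wall /level /height mul1r; rewrite (_ : _ - _ = 0) ?mul0r //; ring.
Qed.

Lemma chart_gap s s' t x : floor x = 0 -> chart s t x 0 = chart s' t x 0.
Proof. by move=> f0; rewrite /chart /level f0 mul0r addr0 sqrtr0 /signed oppr0 !if_same. Qed.

Lemma chart_hole s t t' x : in_hole x -> chart s t x 0 = chart s t' x 0.
Proof.
case=> k kg c0; rewrite /chart (_ : wall x _ = 0) ?sqrtr0; first by rewrite /signed oppr0 !if_same.
rewrite /wall /level mul0r addr0 (floor_in_hole kg c0) (bigD1 (Ordinal kg)) //=.
by rewrite [X in _ * (X * _)](_ : _ = 0) ?mul0r ?mulr0 // /cap; ring.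
Qed.

Lemma chart_cover x y z :
  z ^+ 2 = (rad ^+ 2 - x ^+ 2 - y ^+ 2) * \prod_(i < g) ((x - (3 * i)%:R) ^+ 2 + y ^+ 2 - 1) ->
  exists s t v, [/\ - rad <= x <= rad, 0 <= v <= 1 & (x, y, z) = chart s t x v].
Proof.
rewrite -/(wall x (y ^+ 2)) => zE; set Y := y ^+ 2.
have Y0 : 0 <= Y by apply: sqr_ge0.
have w0 : 0 <= wall x Y by rewrite -zE sqr_ge0.
have r1 : 1 <= rad by rewrite radE; have : 0 <= g%:R :> R by []; lra.
have leY : Y <= rad ^+ 2 - x ^+ 2.
  (* Beyond the outer circle the first factor is negative and the others are positive, which
     contradicts [z ^ 2 >= 0]. *)
  rewrite leNgt; apply/negP => gt; move: w0; rewrite leNgt => /negP; apply.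
  rewrite /wall nmulr_rlt0; last by lra.
  apply: prodr_gt0 => i _.
  have h1 : (3 * i)%:R + 4 <= rad :> R by rewrite -natrD ler_nat; have := ltn_ord i; lia.
  have h2 : 0 <= (3 * i)%:R :> R by [].
  move: gt h1 h2 r1; move: (3 * i)%:R rad => c r gt h1 h2 r1.
  have [hx|hx] := lerP x r; first by nra.
  by nra.
have hx : - rad <= x <= rad.
  have x2 : x ^+ 2 <= rad ^+ 2 by lra.
  by move: x2 r1; move: rad => r x2 r1; apply/andP; split; nra.
have h0 := height_ge0 hx.
have geY : floor x <= Y.
  have [->//|[k kg [c0 fE]]] := floor_cases x.
  (* Inside the hole [k] the factor of index [k] is the only negative one. *)
  rewrite leNgt; apply/negP => lt; move: w0; rewrite leNgt => /negP; apply.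
  rewrite /wall (bigD1 (Ordinal kg)) //= pmulr_rlt0; last by move: h0; rewrite /height; lra.
  rewrite nmulr_rlt0; last by move: lt; rewrite fE /cap; lra.
  apply: prodr_gt0 => i ne.
  have : k != i by rewrite eq_sym; apply: contra ne => /eqP e; apply/eqP/val_inj.
  by move/holes_apart' => /(_ x (ltW c0)); rewrite /cap; lra.
have [v [hv vE]] : exists v, 0 <= v <= 1 /\ Y = level x v.
  have [e|h1] := rim_or hx.
    exists 0; split; first by rewrite lexx ler01.
    have [f0 h0'] := rim e; rewrite /level mul0r addr0 f0; lra.
  exists ((Y - floor x) / height x); split; last first.
    by rewrite /level divfK ?gt_eqF //; ring.
  apply/andP; split; first by apply: divr_ge0 => //; rewrite subr_ge0.
  by rewrite ler_pdivrMr // mul1r /height; lra.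
have sgn a A : a ^+ 2 = A -> exists s, a = signed s (Num.sqrt A).
  move=> <-; rewrite sqrtr_sqr; exists (0 <= a); rewrite /signed.
  by case: ltrgt0P => h; rewrite ?oppr0 ?opprK.
have [s sE] := sgn y Y erefl; have [t tE] := sgn z _ zE.
by exists s, t, v; split=> //; rewrite /chart -vE -sE -tE.
Qed.

End Profile.

(** * The grid on the four charts and the gluing of its cells *)

Section Grid.
Import Order.TTheory GRing.Theory Num.Theory.
Local Open Scope ring_scope.
Variables (R : rcfType) (g n' : nat).
Local Notation n := n'.+1.
Local Notation N := ((6 * g + 2) * n)%N.
Local Notation N' := N.-1.
Local Notation rad := (rad R g).

(** The width [2 * rad = 6 * g + 2] is cut into unit columns. After the shift by [rad = 3 * g + 1],
    the hole [k] spans the columns [3 * g + 3 * k] and [3 * g + 3 * k + 1]. *)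
Definition hole_col (m : nat) := (3 * g <= m < 6 * g)%N && (m %% 3 < 2)%N.
Definition in_col (m : nat) (x : R) := m%:R - rad <= x <= m.+1%:R - rad.

Let natrS m : m.+1%:R = m%:R + 1 :> R. Proof. by rewrite -addn1 natrD. Qed.
Let natr3 k : (3 * k)%:R = 3 * k%:R :> R. Proof. by rewrite natrM. Qed.
Let natr33 k : (3 * g + 3 * k)%:R = 3 * g%:R + 3 * k%:R :> R.
Proof. by rewrite natrD !natr3. Qed.
Let natr33D k c : (3 * g + 3 * k + c)%:R = 3 * g%:R + 3 * k%:R + c%:R :> R.
Proof. by rewrite natrD natr33. Qed.

Lemma hole_col_cap m : hole_col m ->
  exists2 k, (k < g)%N & m = (3 * g + 3 * k)%N \/ m = (3 * g + 3 * k).+1.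
Proof. by case/andP=> /andP[h1 h2] h3; exists ((m - 3 * g) %/ 3)%N; lia. Qed.

Lemma hole_col_capR m : hole_col m -> exists2 k, (k < g)%N &
  m%:R = 3 * g%:R + 3 * k%:R :> R \/ m%:R = 3 * g%:R + 3 * k%:R + 1 :> R.
Proof.
case/hole_col_cap=> k kg [|] ->; exists k => //; [left|right].
  by rewrite natr33.
by rewrite natrS natr33.
Qed.

Lemma hole_col_in_hole m x : hole_col m -> in_col m x -> in_hole g x.
Proof.
case/hole_col_capR=> k kg mE /andP[]; rewrite natrS radE => h1 h2.
exists k => //; apply/cap_ge0P; rewrite natr3.
by case: mE => e; rewrite e in h1 h2; apply/andP; split; lra.
Qed.

Lemma gap_col_floor m x : ~~ hole_col m -> in_col m x -> floor g x = 0.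
Proof.
move=> nh /andP[]; rewrite natrS radE => h1 h2.
case: (floor_cases g x) => [//|[k kg [/cap_gt0P/andP[]]]]; rewrite natr3 => h3 h4 _.
case/negP: nh.
have l1 : (m%:R < (3 * g + 3 * k + 2)%:R :> R) by rewrite natr33D; lra.
have l2 : ((3 * g + 3 * k)%:R < m.+1%:R :> R) by rewrite natrS natr33; lra.
by move: l1 l2; rewrite !ltr_nat => l1 l2; apply/andP; lia.
Qed.

Lemma hole_col_floor m x : hole_col m -> in_col m x -> floor g x = 0 ->
  x = m%:R - rad \/ x = m.+1%:R - rad.
Proof.
case/hole_col_capR=> k kg mE; rewrite /in_col natrS radE => /andP[h1 h2] f0.
have := cap_le_floor x kg; rewrite f0 => c0.
have n0 : ~ (3 * k%:R - 1 < x < 3 * k%:R + 1) by rewrite -natr3 => /cap_gt0P; lra.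
case: mE => e; rewrite e in h1 h2 *; [left|right]; apply/eqP; rewrite eq_le ?h1 ?h2 ?andbT /=;
  rewrite leNgt; apply/negP => lt; apply: n0; apply/andP; split; lra.
Qed.

Lemma gap_col_hole m x : ~~ hole_col m -> in_col m x -> in_hole g x ->
  x = m%:R - rad \/ x = m.+1%:R - rad.
Proof.
move=> nh; rewrite /in_col natrS radE => /andP[h1 h2] [k kg /cap_ge0P/andP[]].
rewrite natr3 => h3 h4.
have : (m.+1 <= 3 * g + 3 * k)%N \/ (3 * g + 3 * k + 2 <= m)%N.
  by move: nh; rewrite /hole_col negb_and -!leqNgt; lia.
case=> le; [right|left]; apply/eqP; rewrite eq_le.
  have : m.+1%:R <= (3 * g + 3 * k)%:R :> R by rewrite ler_nat.
  by rewrite natrS natr33 h2 /=; lra.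
have : (3 * g + 3 * k + 2)%:R <= m%:R :> R by rewrite ler_nat.
by rewrite natr33D h1 andbT; lra.
Qed.

Lemma floor_between m : floor g (m.+1%:R - rad) = 0 -> ~~ (hole_col m && hole_col m.+1).
Proof.
move=> f0; apply/negP => /andP[/hole_col_cap[k kg h1] /hole_col_cap[k' kg' h2]].
have e : m = (3 * g + 3 * k)%N by lia.
have := cap_le_floor (m.+1%:R - rad) kg; rewrite f0 /cap radE (natrS m) e natr33 natr3.
rewrite [X in X ^+ 2](_ : _ = 0); last by ring.
by rewrite expr0n /= subr0; lra.
Qed.

Definition xs (i : nat) : R := i%:R / n%:R - rad.
Definition vs (j : nat) : R := j%:R / n%:R.

Let n_gt0 : 0 < n%:R :> R. Proof. by rewrite ltr0n. Qed.

Lemma in_col_xs m i : (m * n <= i <= m.+1 * n)%N -> in_col m (xs i).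
Proof.
case/andP=> h1 h2; rewrite /in_col /xs !lerB // ?ler_pdivlMr ?ler_pdivrMr // -natrM ler_nat //.
Qed.

Lemma xs_col m i : xs i = m%:R - rad -> i = (m * n)%N.
Proof.
move/addIr/(congr1 ( *%R^~ n%:R)); rewrite /= divfK ?gt_eqF // -natrM => /eqP.
by rewrite eqr_nat => /eqP.
Qed.

Lemma xs_inj : injective xs.
Proof.
move=> i i' /addIr/(congr1 ( *%R^~ n%:R)); rewrite /= !divfK ?gt_eqF // => /eqP.
by rewrite eqr_nat => /eqP.
Qed.

Lemma vs_inj : injective vs.
Proof.
move=> i i' /(congr1 ( *%R^~ n%:R)); rewrite /= !divfK ?gt_eqF // => /eqP.
by rewrite eqr_nat => /eqP.
Qed.

Lemma vs0 : vs 0 = 0. Proof. by rewrite /vs mul0r. Qed.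
Lemma vsn : vs n = 1. Proof. by rewrite /vs divff ?gt_eqF. Qed.
Lemma xs0 : xs 0 = - rad. Proof. by rewrite /xs mul0r add0r. Qed.
Lemma xsN : xs N = rad.
Proof. by rewrite /xs natrM mulfK ?gt_eqF // radE natrD natrM; ring. Qed.

Lemma xs_le i i' : (xs i <= xs i') = (i <= i')%N.
Proof. by rewrite lerD2r ler_pM2r ?invr_gt0 // ler_nat. Qed.

Lemma vs_le i i' : (vs i <= vs i') = (i <= i')%N.
Proof. by rewrite ler_pM2r ?invr_gt0 // ler_nat. Qed.

Lemma xs_range i : (i <= N)%N -> - rad <= xs i <= rad.
Proof. by move=> iN; rewrite -xs0 -xsN !xs_le leq0n. Qed.

Lemma vs_range j : (j <= n)%N -> 0 <= vs j <= 1.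
Proof. by move=> jn; rewrite -vs0 -vsn !vs_le leq0n. Qed.

(** In a hole column the floor of a vertex can vanish only at the outer end of the hole; if this is
    the left end of the column, the preceding column is a gap that also contains the vertex. *)
Lemma gap_vertex i : (i <= N)%N -> floor g (xs i) = 0 ->
  exists2 m, (m < 6 * g + 2)%N & ~~ hole_col m /\ (m * n <= i <= m.+1 * n)%N.
Proof.
move=> iN f0; have [iE|iltN] := leqP N i.
  exists (6 * g + 1)%N; first by lia.
  by split; [rewrite /hole_col; lia | nia].
have m0C : (i %/ n < 6 * g + 2)%N by rewrite ltn_divLR.
have colE : (i %/ n * n <= i <= (i %/ n).+1 * n)%N.
  by rewrite leq_divM ltnW // ltn_ceil.
have [h|nh] := boolP (hole_col (i %/ n)); last by exists (i %/ n)%N.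
have [e|e] := hole_col_floor h (in_col_xs colE) f0; last first.
  by have := xs_col e; have := ltn_ceil i (ltn0Sn n') => ? ?; lia.
have iE := xs_col e.
case: (i %/ n)%N h e iE m0C => [|m] h e iE mC; first by move: h; rewrite /hole_col; lia.
have : ~~ hole_col m.
  by rewrite e in f0; have := floor_between f0; rewrite h andbT.
by exists m; [lia | split=> //; rewrite iE; nia].
Qed.

Lemma hole_vertex i : in_hole g (xs i) ->
  exists2 m, (m < 6 * g + 2)%N & hole_col m /\ (m * n <= i <= m.+1 * n)%N.
Proof.
case=> k kg /cap_ge0P/andP[]; rewrite natr3 /xs radE => h1 h2.
have l1 : ((3 * g + 3 * k) * n <= i)%N.
  rewrite -(ler_nat R) natrM -ler_pdivlMr // natr33.
  by move: h1; move: (i%:R / _) => w h1; lra.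
have l2 : (i <= (3 * g + 3 * k + 2) * n)%N.
  rewrite -(ler_nat R) natrM -ler_pdivrMr // natr33D.
  by move: h2; move: (i%:R / _) => w h2; lra.
have [le|lt] := leqP i ((3 * g + 3 * k).+1 * n).
  exists (3 * g + 3 * k)%N; first by lia.
  by split; [rewrite /hole_col; lia | rewrite l1 le].
exists (3 * g + 3 * k).+1; first by lia.
by split; [rewrite /hole_col; lia | rewrite ltnW // -addn2].
Qed.

Local Notation T := ('I_N'.+1 * 'I_n * bool * bool)%type.
Local Notation dart := (T * (bool * bool))%type.

Let NE : N'.+1 = N. Proof. by rewrite prednK // muln_gt0 addn_gt0 orbT. Qed.

Let ordN (i : 'I_N'.+1) : (i < N)%N.
Proof. by case: i => k /=; rewrite {1}NE. Qed.

Definition pos i j s t : R * R * R := chart g s t (xs i) (vs j).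

(* The side [(v, h)] of a cell is vertical if [v], and the one with the larger
   abscissa (or ordinate) if [h]. *)
Definition dart_src (d : dart) :=
  let: (i, j, s, t, (v, h)) := d in pos (i + (v && h)) (j + (~~ v && h)) s t.
Definition dart_tgt (d : dart) :=
  let: (i, j, s, t, (v, h)) := d in pos (i + (v ==> h)) (j + (v || h)) s t.

(** Sides are glued to the neighbour inside a chart; along the outer circle to the other value of
    [t]; along the bottom row to the other value of [t] over a hole and of [s] over a gap. The
    extreme vertical sides collapse to points and are glued to themselves. *)
Definition flip (d : dart) : dart :=
  let: (i, j, s, t, (v, h)) := d in
  if v then
    if h then if i == N' :> nat then d else (inord i.+1, j, s, t, (true, false))
    else if i == 0%N :> nat then d else (inord i.-1, j, s, t, (true, true))
  else
    if h then
      if j == n' :> nat then (i, j, s, ~~ t, (false, true))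
      else (i, inord j.+1, s, t, (false, false))
    else if j == 0%N :> nat then
      if hole_col (i %/ n) then (i, j, s, ~~ t, (false, false))
      else (i, j, ~~ s, t, (false, false))
    else (i, inord j.-1, s, t, (false, true)).

Lemma flipK : involutive flip.
Proof.
case=> [[[[i j] s] t] [[] []]] /=.
- have [e|ne] := eqVneq (i : nat) N'; first by rewrite /= e eqxx.
  have lt : (i.+1 < N'.+1)%N by rewrite ltn_neqAle eqSS ne ltn_ord.
  by rewrite /= inordK //= inord_val.
- have [e|ne] := eqVneq (i : nat) 0%N; first by rewrite /= e eqxx.
  have i0 : (0 < i)%N by rewrite lt0n.
  have lt : (i.-1 < N'.+1)%N by apply: leq_ltn_trans (leq_pred _) (ltn_ord i).
  by rewrite /= inordK // (prednK i0) inord_val; have := ltn_ord i; case: eqP => // h; lia.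
- have [e|ne] := eqVneq (j : nat) n'; first by rewrite /= e eqxx negbK.
  have lt : (j.+1 < n)%N by rewrite ltn_neqAle eqSS ne ltn_ord.
  by rewrite /= inordK //= inord_val.
have [e|ne] := eqVneq (j : nat) 0%N.
  by case: ifP => h /=; rewrite e eqxx h negbK.
have j0 : (0 < j)%N by rewrite lt0n.
have lt : (j.-1 < n)%N by apply: leq_ltn_trans (leq_pred _) (ltn_ord j).
by rewrite /= inordK // (prednK j0) inord_val; have := ltn_ord j; case: eqP => // h; lia.
Qed.

Lemma pos_left j j' s s' t t' : pos 0 j s t = pos 0 j' s' t'.
Proof. by rewrite /pos xs0; apply: chart_rim; rewrite sqrrN. Qed.

Lemma pos_right j j' s s' t t' : pos N j s t = pos N j' s' t'.
Proof. by rewrite /pos xsN; apply: chart_rim. Qed.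

Lemma pos_top i s t t' : pos i n s t = pos i n s t'.
Proof. by rewrite /pos vsn; apply: chart_top. Qed.

Lemma pos_gap i s s' t : floor g (xs i) = 0 -> pos i 0 s t = pos i 0 s' t.
Proof. by rewrite /pos vs0; apply: chart_gap. Qed.

Lemma pos_hole i s t t' : in_hole g (xs i) -> pos i 0 s t = pos i 0 s t'.
Proof. by rewrite /pos vs0; apply: chart_hole. Qed.

Lemma in_col_cell i b : in_col (i %/ n) (xs (i + (b : bool))).
Proof.
apply: in_col_xs; have h1 := leq_divM i n; have h2 := ltn_ceil i (ltn0Sn n').
by case: b; lia.
Qed.

Lemma flip_ends d : dart_src (flip d) = dart_src d /\ dart_tgt (flip d) = dart_tgt d.
Proof.
case: d => [[[[i j] s] t] [[] []]] /=.
- have [e|ne] := eqVneq (i : nat) N'; first by [].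
  have lt : (i.+1 < N'.+1)%N by rewrite ltn_neqAle eqSS ne ltn_ord.
  by rewrite /= inordK // !addn0 !addn1.
- have [e|ne] := eqVneq (i : nat) 0%N; first by [].
  have i0 : (0 < i)%N by rewrite lt0n.
  have lt : (i.-1 < N'.+1)%N by apply: leq_ltn_trans (leq_pred _) (ltn_ord i).
  by rewrite /= inordK // !addn0 !addn1 (prednK i0).
- have [e|ne] := eqVneq (j : nat) n'; first by rewrite /= e !addn1; split; apply: pos_top.
  have lt : (j.+1 < n)%N by rewrite ltn_neqAle eqSS ne ltn_ord.
  by rewrite /= inordK // !addn0 !addn1.
have [e|ne] := eqVneq (j : nat) 0%N.
  have c b := in_col_cell i b.
  by case: ifP => h; rewrite /= e !addn0; split; (apply: pos_hole || apply: pos_gap);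
    have := c true; have := c false; rewrite ?addn0 ?addn1 => c0 c1;
    ((apply: hole_col_in_hole; eassumption) || (apply: gap_col_floor; [apply/negbT; eassumption | eassumption])).
have j0 : (0 < j)%N by rewrite lt0n.
have lt : (j.-1 < n)%N by apply: leq_ltn_trans (leq_pred _) (ltn_ord j).
by rewrite /= inordK // !addn0 !addn1 (prednK j0).
Qed.

Lemma flip_loop d : flip d = d -> dart_src d = dart_tgt d.
Proof.
case: d => [[[[i j] s] t] [[] []]] /=.
- have [e _|//] := eqVneq (i : nat) N'; rewrite e addn1 NE; exact: pos_right.
- by have [e _|//] := eqVneq (i : nat) 0%N; rewrite e; apply: pos_left.
- by case: ifP => // _ []; case: (t).
case: ifP => [_|_]; last by [].
by case: ifP => _ []; [case: (t) | case: (s)].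
Qed.

(** Each corner of a cell is an end of two of its sides. *)
Lemma dart_boundary (phi : R * R * R -> 'F_2) f :
  \sum_(a : bool * bool) (phi (dart_src (f, a)) + phi (dart_tgt (f, a))) = 0.
Proof.
case: f => [[[i j] s] t].
pose G v h := phi (dart_src (i, j, s, t, (v, h))) + phi (dart_tgt (i, j, s, t, (v, h))).
rewrite (eq_bigr (fun a => G a.1 a.2)) => [|[v h] _ //].
rewrite -(pair_bigA _ G) /= !big_bool /G /= !addn0 -!/(pos _ _ _ _).
move: (phi _) (phi (pos i j s t)) (phi (pos (i + 1) j s t)) (phi (pos i (j + 1) s t)) => a b c d.
transitivity ((a + a) + (b + b) + (c + c) + (d + d)); first by ring.
by rewrite !F2_addrr ?addr0.
Qed.

Lemma dart_boundary4 (y : dart -> 'F_2) f : \sum_(a : bool * bool) y (f, a) =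
  y (f, (true, true)) + y (f, (true, false)) + y (f, (false, true)) + y (f, (false, false)).
Proof.
pose G v h := y (f, (v, h)); rewrite (eq_bigr (fun a => G a.1 a.2)) => [|[v h] _ //].
by rewrite -(pair_bigA _ G) /= !big_bool /G /= addrA.
Qed.

(** * Integration of cocycles on the grid *)

Section Periods.

Variable y : dart -> 'F_2.
Hypothesis y_cocycle : cocycle flip dart_src dart_tgt y.

Local Notation cell i j s t := (inord i, inord j, s, t).

(** The line [j = n] has no cell above it, so its edges are read as the top sides of the row
    [n']. *)
Definition hor i j s t := if (j < n)%N then y (cell i j s t, (false, false))
  else y (cell i n' s t, (false, true)).
(** The potential of [y], integrated along horizontal lines from the left end, where they all
    meet. *)
Definition phi i j s t := locked (\sum_(i' < i) hor i' j s t).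

Lemma phiE i j s t : phi i j s t = \sum_(i' < i) hor i' j s t.
Proof. by rewrite /phi -lock. Qed.

Lemma phiS i j s t : phi i.+1 j s t = phi i j s t + hor i j s t.
Proof. by rewrite !phiE big_ord_recr. Qed.

Lemma y_flip d : y (flip d) = y d. Proof. by case: y_cocycle => ->. Qed.

Lemma y_top i j s t : (j < n)%N -> y (cell i j s t, (false, true)) = hor i j.+1 s t.
Proof.
move=> jn; rewrite /hor; case: ltnP => [j1n|nj1].
  by rewrite -[LHS]y_flip /= inordK // ifN //; lia.
by congr y; congr (_, inord _, _, _, _); lia.
Qed.

(** Induction on the columns: vertical sides at the left end are degenerate, and the cocycle
    relation of a cell passes the formula from its left side to its right side. *)
Lemma y_left_right i j s t : (i < N)%N -> (j < n)%N ->
  y (cell i j s t, (true, false)) = phi i j s t + phi i j.+1 s t /\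
  y (cell i j s t, (true, true)) = phi i.+1 j s t + phi i.+1 j.+1 s t.
Proof.
have [_ y_loop y_cell] := y_cocycle.
move=> iN jn; have step k : (k < N)%N ->
    y (cell k j s t, (true, false)) = phi k j s t + phi k j.+1 s t ->
    y (cell k j s t, (true, true)) = phi k.+1 j s t + phi k.+1 j.+1 s t.
  move=> kN e; have := y_cell (cell k j s t); rewrite dart_boundary4 e y_top // !phiS.
  rewrite [y (_, (false, false))](_ : _ = hor k j s t); last by rewrite /hor jn.
  move: (y _) (phi k j s t) (phi k j.+1 s t) (hor k j s t) (hor k j.+1 s t) => a b c d h e0.
  by apply/F2_addr_eq0; rewrite -e0; ring.
suff left : y (cell i j s t, (true, false)) = phi i j s t + phi i j.+1 s t by split=> //; apply: step.
elim: i iN => [|i IH] iN.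
  rewrite !phiE !big_ord0 addr0 y_loop //= (inordK (ltn0Sn N')).
  exact: pos_left.
rewrite -step ?IH //; [|lia..].
rewrite -[LHS]y_flip /= (inordK (m := i.+1)) ?NE //.
Qed.

Lemma phi_bottom i j s t : (j < n)%N ->
  y (cell i j s t, (false, false)) = phi i j s t + phi i.+1 j s t.
Proof. by move=> jn; rewrite phiS addrA F2_addrr add0r /hor jn. Qed.

Lemma phi_top i j s t : (j < n)%N ->
  y (cell i j s t, (false, true)) = phi i j.+1 s t + phi i.+1 j.+1 s t.
Proof. by move=> jn; rewrite phiS addrA F2_addrr add0r y_top. Qed.

Lemma phi0 j s t : phi 0 j s t = 0. Proof. by rewrite phiE big_ord0. Qed.

Lemma phiN j j' s t : (j <= n)%N -> (j' <= n)%N -> phi N j s t = phi N j' s t.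
Proof.
have eq0 k : (k <= n)%N -> phi N k s t = phi N 0 s t; last first.
  by move=> h h'; rewrite (eq0 _ h) (eq0 _ h').
elim: k => [//|k IH] kn; rewrite -(IH (ltnW kn)); apply/esym/F2_addr_eq0.
have NN : (N' < N)%N by rewrite -ltnS NE.
have [_ y_loop _] := y_cocycle; have [_] := y_left_right s t NN kn.
have phiNE l : phi N'.+1 l s t = phi N l s t by rewrite NE.
rewrite !phiNE => <-; apply: y_loop; rewrite /= inordK ?NE // addn1 NE; apply: pos_right.
Qed.

Lemma phi_flip_top i s t : phi i n s t = phi i n s (~~ t).
Proof.
rewrite !phiE; apply: eq_bigr => k _; rewrite /hor ltnn -[LHS]y_flip /= inordK // eqxx //.
Qed.

Lemma hor_hole i s t : (i < N)%N -> hole_col (i %/ n) -> hor i 0 s t = hor i 0 s (~~ t).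
Proof.
by move=> iN h; rewrite /hor /= -[LHS]y_flip /= !inordK ?NE //= h.
Qed.

Lemma hor_gap i s t : (i < N)%N -> ~~ hole_col (i %/ n) -> hor i 0 s t = hor i 0 (~~ s) t.
Proof.
by move=> iN h; rewrite /hor /= -[LHS]y_flip /= !inordK ?NE //= (negPf h).
Qed.

(** The bottom of each unit column joins two pairs of charts; a period is the mismatch of the
    potentials of one pair at the left end of the column. There are [2 * (6 * g + 2)] periods, more
    than the Betti number [2 * g] but still linear in [g]. *)
Definition period (mr : 'I_(6 * g + 2) * bool) : 'F_2 :=
  let: (m, r) := mr in
  if hole_col m then phi (m * n) 0 r true + phi (m * n) 0 r false
  else phi (m * n) 0 true r + phi (m * n) 0 false r.

Hypothesis period0 : forall mr, period mr = 0.

Let col_lt m k : (m < 6 * g + 2)%N -> (k < n)%N -> (m * n + k < N)%N.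
Proof.
move=> mC kn; apply: (@leq_trans (m.+1 * n)); last by rewrite leq_mul2r mC orbT.
by rewrite mulSn addnC ltn_add2r.
Qed.

(** The glued sheets have equal increments along the bottom of the column, so agreement at its left
    end propagates. *)
Lemma phi_hole m i s t t' : (m < 6 * g + 2)%N -> hole_col m -> (m * n <= i <= m.+1 * n)%N ->
  phi i 0 s t = phi i 0 s t'.
Proof.
move=> mC h; suff tf k : (k <= n)%N -> phi (m * n + k) 0 s true = phi (m * n + k) 0 s false.
  move=> hi; have -> : i = (m * n + (i - m * n))%N by lia.
  by case: t t' => -[] //; rewrite tf //; lia.
elim: k => [_|k IH kn].
  by rewrite addn0; apply/F2_addr_eq0; have := period0 (Ordinal mC, s); rewrite /= h.
have kN := col_lt mC kn.
have hh := @hor_hole (m * n + k) s true kN; rewrite divnMDl // divn_small // addn0 in hh.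
by rewrite addnS 2!phiS (IH (ltnW kn)) (hh h).
Qed.

Lemma phi_gap m i s s' t : (m < 6 * g + 2)%N -> ~~ hole_col m -> (m * n <= i <= m.+1 * n)%N ->
  phi i 0 s t = phi i 0 s' t.
Proof.
move=> mC h; suff tf k : (k <= n)%N -> phi (m * n + k) 0 true t = phi (m * n + k) 0 false t.
  move=> hi; have -> : i = (m * n + (i - m * n))%N by lia.
  by case: s s' => -[] //; rewrite tf //; lia.
elim: k => [_|k IH kn].
  by rewrite addn0; apply/F2_addr_eq0; have := period0 (Ordinal mC, t); rewrite /= (negPf h).
have kN := col_lt mC kn.
have hh := @hor_gap (m * n + k) true t kN; rewrite divnMDl // divn_small // addn0 in hh.
by rewrite addnS 2!phiS (IH (ltnW kn)) (hh h).
Qed.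

(** The potential respects every identification of [chart_inj]: the outer circle by [phi_flip_top],
    the bottom because the periods vanish. *)
Lemma phi_pos i j s t i' j' s' t' : (i <= N)%N -> (j <= n)%N -> (i' <= N)%N -> (j' <= n)%N ->
  pos i j s t = pos i' j' s' t' -> phi i j s t = phi i' j' s' t'.
Proof.
move=> iN jn i'N j'n /(chart_inj (xs_range iN) (vs_range jn) (vs_range j'n))[/xs_inj e].
subst i'; case=> [rim|[/vs_inj e es et]].
  have : xs i = xs 0 \/ xs i = xs N.
    by move/eqP: rim; rewrite eqf_sqr xs0 xsN => /orP[]/eqP ->; [right|left].
  case=> /xs_inj ->; first by rewrite !phi0.
  (* At the right end all charts meet: [t] is exchanged along the outer circle, and [s] along the
     bottom of the last column, which is a gap. *)
  have C1 : (6 * g + 1 < 6 * g + 2)%N by rewrite ltn_add2l.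
  have nh : ~~ hole_col (6 * g + 1) by rewrite /hole_col; lia.
  rewrite (@phiN j n) // (@phiN j' n) //.
  have -> : phi N n s t = phi N n s t' by case: t t' => -[] //; rewrite phi_flip_top.
  rewrite (@phiN n 0) // (@phiN n 0) //.
  by apply: (phi_gap _ _ _ C1 nh); nia.
subst j'; transitivity (phi i j s' t).
  case: es => [-> //|[v0 f0]].
  have -> : j = 0%N by apply: vs_inj; rewrite vs0.
  by have [m mC [nh hi]] := gap_vertex iN f0; apply: phi_gap hi.
case: et => [-> //|v1|[v0 f0]].
  have -> : j = n by apply: vs_inj; rewrite vsn.
  by case: t t' => -[] //; rewrite phi_flip_top.
have -> : j = 0%N by apply: vs_inj; rewrite vs0.
by have [m mC [nh hi]] := hole_vertex f0; apply: phi_hole hi.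
Qed.

End Periods.

Definition periods (y : dart -> 'F_2) := [ffun mr => period y mr].

(** The sum of the two cocycles has zero periods, so by [phi_pos] its potential depends only on the
    grid point and not on its parameters. *)
Lemma periodsP y y' : cocycle flip dart_src dart_tgt y -> cocycle flip dart_src dart_tgt y' ->
  periods y = periods y' ->
  exists f : R * R * R -> 'F_2, forall d, y d + y' d = f (dart_src d) + f (dart_tgt d).
Proof.
move=> cy cy' /ffunP per_eq; pose z d := y d + y' d.
have cz : cocycle flip dart_src dart_tgt z.
  case: cy cy' => [f1 l1 c1] [f2 l2 c2]; split=> [d|d e|f]; rewrite /z ?f1 ?f2 //.
    by rewrite l1 // l2 // addr0.
  by rewrite big_split /= c1 c2 addr0.
have phiD i j s t : phi z i j s t = phi y i j s t + phi y' i j s t.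
  by rewrite !phiE -big_split; apply: eq_bigr => k _; rewrite /hor; case: ifP.
have z0 mr : period z mr = 0.
  have := per_eq mr; rewrite !ffunE => e.
  have -> : period z mr = period y mr + period y' mr.
    by case: mr {e} => m r; rewrite /period !phiD; case: ifP => _; ring.
  by rewrite e F2_addrr.
pose f p := if [pick u : 'I_N.+1 * 'I_n.+1 * bool * bool |
    pos u.1.1.1 u.1.1.2 u.1.2 u.2 == p] is Some u
  then phi z u.1.1.1 u.1.1.2 u.1.2 u.2 else 0.
have fE i j s t : (i <= N)%N -> (j <= n)%N -> f (pos i j s t) = phi z i j s t.
  move=> iN jn; rewrite /f; case: pickP => [[[[i1 j1] s1] t1] /= /eqP e|].
    by apply: (phi_pos cz z0 _ _ _ _ e); rewrite -ltnS.
  by move/(_ (inord i, inord j, s, t)); rewrite /= !inordK // eqxx.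
exists f; case=> [[[[i j] s] t] [v h]]; rewrite -/(z _).
have iN := ordN i.
have jn := ltn_ord j.
have le1 (a : bool) k M : (k < M)%N -> (k + a <= M)%N by case: a; lia.
rewrite /= !fE ?le1 // -[i in LHS]inord_val -[j in LHS]inord_val.
case: v h => -[] /=; rewrite ?addn0 ?addn1.
- by case: (y_left_right cz s t iN jn).
- by case: (y_left_right cz s t iN jn).
- exact: phi_top.
exact: phi_bottom.
Qed.

Definition corner (f : T) (a b : bool) := let: (i, j, s, t) := f in pos (i + a) (j + b) s t.

Definition in_cell (f : T) p := let: (i, j, s, t) := f in exists x v,
  [/\ xs i <= x <= xs i.+1, vs j <= v <= vs j.+1 & p = chart g s t x v].

Lemma dart_corner f (v h : bool) : dart_src (f, (v, h)) = corner f (v && h) (~~ v && h) /\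
  dart_tgt (f, (v, h)) = corner f (v ==> h) (v || h).
Proof. by case: f => [[[i j] s] t]. Qed.

Lemma common_index (i i' : nat) (w : R) : i%:R <= w <= i.+1%:R -> i'%:R <= w <= i'.+1%:R ->
  exists a a' : bool, (i + a = i' + a')%N /\ (w = (i + a)%:R \/ i%:R < w < i.+1%:R).
Proof.
move=> /andP[h1 h2] /andP[h3 h4]; case: (ltngtP i i') => [lt|lt|e].
- have le : i.+1%:R <= i'%:R :> R by rewrite ler_nat.
  have e : w = i.+1%:R by apply/eqP; rewrite eq_le h2 (le_trans le).
  have : (i'%:R <= i.+1%:R :> R) by rewrite -e.
  by rewrite ler_nat => le'; exists true, false; rewrite addn0 addn1; split; [lia | left].
- have le : i'.+1%:R <= i%:R :> R by rewrite ler_nat.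
  have e : w = i%:R by apply/eqP; rewrite eq_le h1 (le_trans h4).
  have : (i%:R <= i'.+1%:R :> R) by rewrite -e.
  by rewrite ler_nat => le'; exists false, true; rewrite addn0 addn1; split; [lia | left].
subst i'; have [e|ne1] := eqVneq w i.+1%:R.
  by exists true, true; split=> //; left; rewrite addn1.
have [e|ne0] := eqVneq w i%:R; first by exists false, false; split=> //; left; rewrite addn0.
by exists false, false; split=> //; right; rewrite !lt_neqAle h1 h2 ne1 eq_sym ne0.
Qed.

Lemma xsE x : x = (x + rad) * n%:R / n%:R - rad.
Proof. by rewrite mulfK ?gt_eqF // addrK. Qed.

(** If [x] is not a grid abscissa, the chosen vertex lies in the closed unit column whose interior
    contains [x], so it inherits the gap or hole condition that governs the gluing. *)
Lemma common_abscissa i i' x : xs i <= x <= xs i.+1 -> xs i' <= x <= xs i'.+1 ->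
  exists a a' : bool, [/\ (i + a = i' + a')%N, floor g x = 0 -> floor g (xs (i + a)) = 0 &
    in_hole g x -> in_hole g (xs (i + a))].
Proof.
have scale k : xs k <= x <= xs k.+1 -> k%:R <= (x + rad) * n%:R <= k.+1%:R.
  by rewrite {1 2}(xsE x) /xs !lerD2r !ler_pM2r ?invr_gt0.
move=> hi hi'; have [a [a' [e ew]]] := common_index (scale _ hi) (scale _ hi').
exists a, a'; split=> //; case: ew => [wE|/andP[w1 w2]].
- by rewrite /xs -wE -xsE.
- have {}w1 : xs i < x by rewrite (xsE x) /xs ltrD2r ltr_pM2r ?invr_gt0.
  have {}w2 : x < xs i.+1 by rewrite (xsE x) /xs ltrD2r ltr_pM2r ?invr_gt0.
  have c0 := in_col_cell i a.
  have cx : in_col (i %/ n) x.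
    have := in_col_cell i false; have := in_col_cell i true; rewrite addn0 addn1 /in_col; lra.
  have n1 : x <> (i %/ n)%N%:R - rad.
    by move=> xE; have /andP[] := in_col_cell i false; rewrite addn0 -xE; lra.
  have n2 : x <> (i %/ n).+1%:R - rad.
    by move=> xE; have /andP[] := in_col_cell i true; rewrite addn1 -xE; lra.
  have [h|nh] := boolP (hole_col (i %/ n)); first by move/(hole_col_floor h cx) => [].
  by move=> _; apply: gap_col_floor nh c0.
- by rewrite /xs -wE -xsE.
have {}w1 : xs i < x by rewrite (xsE x) /xs ltrD2r ltr_pM2r ?invr_gt0.
have {}w2 : x < xs i.+1 by rewrite (xsE x) /xs ltrD2r ltr_pM2r ?invr_gt0.
have c0 := in_col_cell i a.
have cx : in_col (i %/ n) x.
  have := in_col_cell i false; have := in_col_cell i true; rewrite addn0 addn1 /in_col; lra.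
have n1 : x <> (i %/ n)%N%:R - rad.
  by move=> xE; have /andP[] := in_col_cell i false; rewrite addn0 -xE; lra.
have n2 : x <> (i %/ n).+1%:R - rad.
  by move=> xE; have /andP[] := in_col_cell i true; rewrite addn1 -xE; lra.
have [h|nh] := boolP (hole_col (i %/ n)); last by move/(gap_col_hole nh cx) => [].
by move=> _; apply: hole_col_in_hole h c0.
Qed.

Lemma common_ordinate j j' v : (j < n)%N -> (j' < n)%N ->
  vs j <= v <= vs j.+1 -> vs j' <= v <= vs j'.+1 ->
  exists b b' : bool, [/\ (j + b = j' + b')%N, v = 0 -> (j + b = 0)%N & v = 1 -> (j + b = n)%N].
Proof.
have scale k : vs k <= v <= vs k.+1 -> k%:R <= v * n%:R <= k.+1%:R.
  by rewrite /vs ler_pdivrMr // ler_pdivlMr.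
move=> jn j'n hj hj'; have [b [b' [e ew]]] := common_index (scale _ hj) (scale _ hj').
exists b, b'; split=> // vE; move: ew; rewrite vE ?mul0r ?mul1r.
  case=> [/eqP|/andP[]]; first by rewrite eq_sym pnatr_eq0 => /eqP.
  by rewrite ltrn0.
case=> [/eqP|/andP[]]; first by rewrite eqr_nat => /eqP.
by rewrite !ltr_nat; lia.
Qed.

(** The cells may belong to different charts: the gluing rule that identifies the two parameters of
    [p] also identifies those of a common grid vertex. This is what keeps traces of connected sets
    connected. *)
Lemma in_cell_share f f' p : in_cell f p -> in_cell f' p ->
  exists a b a' b', corner f a b = corner f' a' b'.
Proof.
case: f f' => [[[i j] s] t] [[[i' j'] s'] t'] [x [v [hx hv ->]]] [x' [v' [hx' hv' e]]].
have iN := ordN i.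
have i'N := ordN i'.
have rx : - rad <= x <= rad.
  have /andP[h1 _] := xs_range (ltnW iN); have /andP[_ h2] := xs_range iN.
  by move: hx; lra.
have rv k w : (k < n)%N -> vs k <= w <= vs k.+1 -> 0 <= w <= 1.
  move=> kn; have /andP[h1 _] := vs_range (ltnW kn); have /andP[_ h2] := vs_range kn.
  by lra.
have [xE] := chart_inj rx (rv _ _ (ltn_ord j) hv) (rv _ _ (ltn_ord j') hv') e; subst x'.
case=> [rim|[vE es et]].
  have : x = xs 0 \/ x = xs N.
    by move/eqP: rim; rewrite eqf_sqr xs0 xsN => /orP[]/eqP ->; [right|left].
  case=> xE; move: hx hx'; rewrite xE !xs_le => /andP[h1 h2] /andP[h3 h4].
    have i0 : (i : nat) = 0%N by lia.
    have i'0 : (i' : nat) = 0%N by lia.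
    by exists false, false, false, false; rewrite /= i0 i'0; apply: pos_left.
  have iE : (i + 1)%N = N by lia.
  have i'E : (i' + 1)%N = N by lia.
  by exists true, true, true, true; rewrite /= iE i'E; apply: pos_right.
subst v'; have [a [a' [eI f0 inh]]] := common_abscissa hx hx'.
have [b [b' [eJ v0 v1]]] := common_ordinate (ltn_ord j) (ltn_ord j') hv hv'.
exists a, b, a', b'; rewrite /= -eI -eJ; transitivity (pos (i + a) (j + b) s' t).
  by case: es => [-> //|[/v0 -> /f0]]; apply: pos_gap.
case: et => [-> //|/v1 ->|[/v0 -> /inh]]; [exact: pos_top|exact: pos_hole].
Qed.

Lemma grid_cover x v : - rad <= x <= rad -> 0 <= v <= 1 -> forall s t,
  exists f, in_cell f (chart g s t x v).
Proof.
have idx (w : R) M : (0 < M)%N -> 0 <= w <= M%:R ->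
    exists2 k, (k < M)%N & k%:R <= w <= k.+1%:R.
  elim: M => // M IH _ /andP[w0 wM]; have [le|lt] := leP w M%:R; last first.
    by exists M => //; rewrite ltW.
  case: M IH wM le => [|M] IH wM le; last first.
    by have [||k kM hk] := IH; rewrite ?w0 //; exists k => //; apply: ltnW.
  by exists 0%N => //; rewrite w0.
move=> /andP[x0 x1] /andP[v0 v1] s t.
have N0 : (0 < N)%N by rewrite -NE.
have [|k kN /andP[k1 k2]] := idx ((x + rad) * n%:R) N N0.
  rewrite mulr_ge0 //=; last by lra.
  rewrite natrM ler_pM2r // natrD natrM; move: x1; rewrite radE; lra.
have [||l ln /andP[l1 l2]] := idx (v * n%:R) n => //.
  by rewrite mulr_ge0 //= ler_piMl // ltW.
rewrite -NE in kN; exists (Ordinal kN, Ordinal ln, s, t), x, v; split=> //=.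
  by rewrite (xsE x) /xs !lerD2r !ler_pM2r ?invr_gt0 // k1.
by rewrite /vs ler_pdivrMr // ler_pdivlMr // l1.
Qed.

End Grid.

(** * Hinges and maximal subgroups of a non-abelian finite simple group *)

Section SimpleGroup.
Local Open Scope group_scope.

Variables (gT : finGroupType) (S : {group gT}).
Hypothesis simS : simple S.
Hypothesis nabS : ~~ abelian S.

Implicit Types D H K M : {group gT}.

Lemma conjG_K H x : ((H :^ x)%G :^ x^-1)%G = H.
Proof. by apply: val_inj; apply: conjsgK. Qed.

Lemma conjG_KV H x : ((H :^ x^-1)%G :^ x)%G = H.
Proof. by apply: val_inj; apply: conjsgKV. Qed.

Lemma conjG_M H x y : (H :^ (x * y))%G = ((H :^ x) :^ y)%G.
Proof. by apply: val_inj; apply: conjsgM. Qed.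

Lemma normal_simple H : H <| S -> H :=: 1 \/ H :=: S.
Proof. by case/simpleP: simS => _; apply. Qed.

Lemma maximal_neq1 M : maximal M S -> M :!=: 1.
Proof.
case/maxgroupP => _ maxM; apply/eqP => M1.
have [x xS xn1] : exists2 x, x \in S & x != 1.
  by case/simpleP: simS => /trivgPn.
have [cS|ncS] := eqVneq <[x]> (S : {set gT}).
  by move: nabS; rewrite -cS cycle_abelian.
have := maxM <[x]>%G; rewrite /= M1 sub1G properEneq ncS cycle_subG xS.
by move=> /(_ isT isT)/eqP; rewrite cycle_eq1 (negPf xn1).
Qed.

Lemma maximal_norm M : maximal M S -> 'N_S(M) = M.
Proof.
move=> mM; have [pM maxM] := maxgroupP mM.
have sMS := proper_sub pM.
have [NS|NS] := eqVneq 'N_S(M) (S : {set gT}).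
  have /normal_simple[M1|MS] : M <| S by rewrite /normal sMS -{1}NS subsetIr.
    by move: (maximal_neq1 mM); rewrite M1 eqxx.
  by rewrite MS properxx in pM.
apply: (maxM 'N_S(M)%G); last by rewrite subsetI sMS normG.
by rewrite properEneq NS subsetIl.
Qed.

Lemma maximal_eq M K : maximal M S -> K \proper S -> M \subset K -> K :=: M.
Proof. by case/maxgroupP => _ maxM; apply: maxM. Qed.

Lemma maximal_conj M x : maximal M S -> x \in S -> maximal (M :^ x) S.
Proof.
move=> /maxgroupP[pM maxM] xS; apply/maxgroupP; split.
  by rewrite -(conjGid xS) properJ.
move=> H pH sMH; have := maxM (H :^ x^-1)%G.
rewrite -{1}(conjGid (groupVr xS)) properJ -sub_conjg => /(_ pH sMH) /= <-.
by rewrite conjsgKV.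
Qed.

Lemma exists_maximal x : x \in S -> exists2 M : {group gT}, maximal M S & x \in M.
Proof.
move=> xS; have sxS : <[x]> \subset S by rewrite cycle_subG.
have [cS|[M mM]] := @maximal_exists _ <[x]>%G S sxS.
  by move: nabS; rewrite -cS cycle_abelian.
by rewrite cycle_subG; exists M.
Qed.

(** Suppose that distinct maximal subgroups meet trivially. The conjugates of a maximal [M] then
    cover [#|S| - #|S : M|] non-trivial elements, at least half of [#|S|] but not all of them. A
    maximal [M'] through a missed element covers at least as many others, and together they exceed
    [#|S| - 1]. *)
Lemma meeting_maximals :
  exists M1 M2 : {group gT}, [/\ maximal M1 S, maximal M2 S, M1 :!=: M2 & M1 :&: M2 != 1].
Proof.
case: (boolP [exists M1 : {group gT}, exists M2 : {group gT},
   [&& maximal M1 S, maximal M2 S, M1 :!=: M2 & M1 :&: M2 != 1]]).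
  by case/existsP=> M1 /existsP[M2 /and4P[]]; exists M1, M2.
move/existsPn=> ti.
have TI M1 M2 y : maximal M1 S -> maximal M2 S -> y != 1 -> y \in M1 -> y \in M2 ->
    M1 :=: M2.
  move=> m1 m2 y1 yM1 yM2; apply/eqP/negPn/negP => ne.
  have /existsPn/(_ M2) := ti M1; rewrite m1 m2 ne /= negbK => /eqP/setP/(_ y).
  by rewrite !inE yM1 yM2 (negPf y1).
pose A M := class_support M^# S.
have AP M y : maximal M S ->
    reflect (y != 1 /\ exists2 x, x \in S & y \in M :^ x) (y \in A M).
  move=> mM; apply: (iffP imset2P) => [[z x]|[y1 [x xS]]].
    rewrite !inE => /andP[z1 zM] xS ->; split; first by rewrite conjg_eq1.
    by exists x => //; rewrite memJ_conjg.
  case/imsetP => z zM yE; exists z x => //; rewrite !inE zM andbT.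
  by apply: contra y1 => /eqP z1; rewrite yE z1 conj1g.
have cardA M : maximal M S -> #|A M| = (#|S| - #|S : M|)%N.
  move=> mM; have sMS := maxgroupp mM.
  (* Distinct conjugates of [M] meet trivially and [M] is its own normaliser. *)
  rewrite (@card_support_normedTI _ _ _ M).
    by rewrite -(Lagrange (proper_sub sMS)) [in RHS](cardsD1 1 M) group1 add1n mulSn addKn.
  apply/normedTI_P; rewrite normD1 maximal_norm // setD_eq0 subG1 maximal_neq1 //; split=> // x xS.
  rewrite -setI_eq0 => /set0Pn[y]; rewrite !inE conjD1g !inE => /andP[/andP[y1 yM] /andP[_ yMx]].
  have MMx := TI M (M :^ x)%G y mM (maximal_conj mM xS) y1 yM yMx.
  by rewrite -(maximal_norm mM) !inE xS /= -MMx.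
have idx M : maximal M S -> (2 * #|S : M| <= #|S|)%N /\ (1 < #|S : M|)%N.
  move=> mM; have pM := maxgroupp mM; split; last by rewrite indexg_gt1 proper_subn.
  rewrite -(Lagrange (proper_sub pM)) leq_mul2r cardG_gt1.
  by rewrite (maximal_neq1 mM) orbT.
have subA M : maximal M S -> A M \subset S^#.
  move=> mM; apply/subsetP => y /(AP _ _ mM)[y1 [x xS yMx]]; rewrite !inE y1 /=.
  by move: y yMx {y1}; apply/subsetP; rewrite sub_conjg conjGid ?groupV // proper_sub ?(maxgroupp mM).
have [M mM _] := exists_maximal (group1 S).
have cardS1 : #|S| = #|S^#|.+1 by rewrite (cardsD1 1 S) group1.
have [x xS xA] : exists2 x, x \in S^# & x \notin A M.
  apply/subsetPn/negP => /subset_leq_card; rewrite cardA // => le.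
  have [] := idx M mM; move: le cardS1; lia.
have [x1 {}xS] := setD1P xS; have [M' mM' xM'] := exists_maximal xS.
have dis : [disjoint A M & A M'].
  rewrite -setI_eq0; apply/eqP/setP => y; rewrite inE in_set0; apply/negP.
  case/andP=> /(AP _ _ mM)[y1 [a aS yMa]] /(AP _ _ mM')[_ [b bS yMb]].
  have e := TI (M :^ a)%G (M' :^ b)%G y (maximal_conj mM aS) (maximal_conj mM' bS) y1 yMa yMb.
  case/negP: xA; apply/(AP _ _ mM); split=> //; exists (a * b^-1); first by rewrite groupM ?groupV.
  by rewrite conjsgM e conjsgK.
have : #|A M| + #|A M'| <= #|S^#|.
  by rewrite -cardsUI; move/disjoint_setI0: dis => ->; rewrite cards0 addn0 subset_leq_card // subUset !subA.
rewrite !cardA // => le; have [l1 _] := idx M mM; have [l2 _] := idx M' mM'.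
by have [] := idx M mM; move: le l1 l2 cardS1; lia.
Qed.

Definition meet_of_maximals D :=
  [exists M1 : {group gT}, exists M2 : {group gT},
    [&& maximal M1 S, maximal M2 S, M1 :!=: M2 & D :==: M1 :&: M2]].

Definition hinge D := [&& meet_of_maximals D, D :!=: 1 &
  [forall D' : {group gT}, meet_of_maximals D' ==> ~~ (D \proper D')]].

Lemma meet_of_maximalsI M1 M2 : maximal M1 S -> maximal M2 S -> M1 :!=: M2 ->
  meet_of_maximals (M1 :&: M2)%G.
Proof.
by move=> m1 m2 ne; apply/existsP; exists M1; apply/existsP; exists M2; rewrite m1 m2 ne /=.
Qed.

(** A non-trivial intersection of largest order works: any intersection strictly above it is
    non-trivial too. *)
Lemma exists_hinge : exists D, hinge D.
Proof.
have [M1 [M2 [m1 m2 ne n1]]] := meeting_maximals.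
pose P (D : {group gT}) := meet_of_maximals D && (D :!=: 1).
have P0 : P (M1 :&: M2)%G by rewrite /P meet_of_maximalsI.
case: (@arg_maxnP _ (M1 :&: M2)%G P (fun D => #|D|) P0) => D /andP[mD D1] maxD.
exists D; apply/and3P; split=> //; apply/forall_inP => D' mD'; apply/negP => pDD'.
have D'1 : D' :!=: 1.
  by apply: contraTneq pDD' => ->; rewrite properE sub1G andbF.
have := maxD D'; rewrite /P mD' D'1 /= => /(_ isT).
by move=> le; have := leq_trans (proper_card pDD') le; rewrite ltnn.
Qed.

Lemma hinge_maximals D : hinge D ->
  exists M1 M2 : {group gT}, [/\ maximal M1 S, maximal M2 S, M1 :!=: M2, D \proper M1 & D \proper M2].
Proof.
case/and3P => /existsP[M1 /existsP[M2 /and4P[m1 m2 ne /eqP DE]]] _ _.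
exists M1, M2; split=> //; rewrite DE properE ?subsetIl ?subsetIr subsetI subxx ?andbT /=.
  apply: contra ne => s12; apply/eqP/esym.
  exact: maximal_eq m1 (maxgroupp m2) s12.
by apply: contra ne => s21; apply/eqP; apply: maximal_eq m2 (maxgroupp m1) s21.
Qed.

Lemma hinge_neq1 D : hinge D -> D :!=: 1. Proof. by case/and3P. Qed.

Lemma hinge_max D D' : hinge D -> meet_of_maximals D' -> ~~ (D \proper D').
Proof. by case/and3P => _ _ /forall_inP; apply. Qed.

Lemma hinge_anti D D' : hinge D -> hinge D' -> ~~ (D \proper D').
Proof. by move=> hD /and3P[mD' _ _]; apply: hinge_max. Qed.

Lemma hinge_proper D : hinge D -> D \proper S.
Proof.
case/hinge_maximals=> M1 [M2 [m1 _ _ p1 _]].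
exact: proper_trans p1 (maxgroupp m1).
Qed.

Lemma hinge_not_maximal D : hinge D -> ~~ maximal D S.
Proof.
case/hinge_maximals=> M1 [M2 [m1 _ _ p1 _]]; apply/negP => mD.
by have := p1; rewrite (maximal_eq mD (maxgroupp m1) (proper_sub p1)) properxx.
Qed.

(** Otherwise [M :&: M'] would be an intersection strictly above the hinge [D]. *)
Lemma hinge_unique D K M M' : hinge D -> D \proper K -> maximal M S -> maximal M' S ->
  K \subset M -> K \subset M' -> M = M'.
Proof.
move=> hD pDK mM mM' sKM sKM'; apply/val_inj/eqP/negPn/negP => ne.
have /negP := hinge_max hD (meet_of_maximalsI mM mM' ne); apply.
by apply: proper_sub_trans pDK _; rewrite subsetI sKM.
Qed.

Lemma meet_of_maximals_conj D x : x \in S -> meet_of_maximals D -> meet_of_maximals (D :^ x)%G.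
Proof.
move=> xS /existsP[M1 /existsP[M2 /and4P[m1 m2 ne /eqP DE]]].
apply/existsP; exists (M1 :^ x)%G; apply/existsP; exists (M2 :^ x)%G.
rewrite !maximal_conj // /= DE conjIg eqxx andbT.
by apply: contra ne => /eqP /(act_inj 'Js)/eqP.
Qed.

Lemma hinge_conj D x : x \in S -> hinge D -> hinge (D :^ x)%G.
Proof.
move=> xS /and3P[mD D1 /forall_inP maxD]; apply/and3P; split.
- exact: meet_of_maximals_conj.
- by apply: contra D1 => /eqP D1; rewrite -(conjsgK x D) D1 conjs1g.
apply/forall_inP => D' mD'; have := maxD (D' :^ x^-1)%G.
rewrite meet_of_maximals_conj ?groupV // => /(_ isT); apply: contra => p.
by rewrite -(properJ _ _ x) conjsgKV.
Qed.

Definition hinge_below : rel {group gT} := fun D M => [&& hinge D, maximal M S & D \proper M].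

Definition hinge_adj : rel {group gT} := fun H K => hinge_below H K || hinge_below K H.

Lemma hinge_adj_sym : symmetric hinge_adj.
Proof. by move=> H K; rewrite /hinge_adj orbC. Qed.

Lemma hinge_below_conj H K x : x \in S -> hinge_below H K -> hinge_below (H :^ x)%G (K :^ x)%G.
Proof.
move=> xS /and3P[hH mK pHK]; apply/and3P; split; first exact: hinge_conj.
  exact: maximal_conj.
by rewrite properJ.
Qed.

Lemma hinge_adj_conj H K x : x \in S -> hinge_adj H K -> hinge_adj (H :^ x)%G (K :^ x)%G.
Proof. by move=> xS /orP[] /(hinge_below_conj xS) h; rewrite /hinge_adj h ?orbT. Qed.

Lemma hinge_adj_type H K : hinge_adj H K -> hinge H = ~~ hinge K.
Proof.
have type D M : hinge_below D M -> hinge D = ~~ hinge M.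
  case/and3P => hD mM _; rewrite hD; apply/esym/negP => hM.
  by have := hinge_not_maximal hM; rewrite mM.
by case/orP => /type // ->; rewrite negbK.
Qed.

Lemma not_normal H : H :!=: 1 -> H \proper S -> exists2 x, x \in S & (H :^ x)%G != H.
Proof.
move=> H1 pHS; have : ~~ (H <| S).
  apply/negP => /normal_simple[HE|HE]; first by rewrite HE eqxx in H1.
  by rewrite HE properxx in pHS.
rewrite /normal proper_sub //= => /subsetPn[x xS nx]; exists x => //.
by apply: contra nx => /eqP/(congr1 val) /= e; rewrite inE e.
Qed.

Definition vtx H := hinge H || maximal H S.

Lemma vtx_neq1 H : vtx H -> H :!=: 1.
Proof. by case/orP => [/hinge_neq1|/maximal_neq1]. Qed.

Lemma vtx_proper H : vtx H -> H \proper S.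
Proof. by case/orP => [/hinge_proper|/maxgroupp]. Qed.

Lemma hinge_adj_vtx H K : hinge_adj H K -> vtx H && vtx K.
Proof. by case/orP => /and3P[h m _]; rewrite /vtx h m ?orbT. Qed.

Definition restr (Y : {set {group gT}}) : rel {group gT} :=
  fun H K => [&& H \in Y, K \in Y & hinge_adj H K].

Lemma restr_sym Y : symmetric (restr Y).
Proof. by move=> H K; rewrite /restr hinge_adj_sym andbCA. Qed.

Definition core (Y : {set {group gT}}) :=
  [&& Y != set0, [forall H in Y, vtx H],
      [forall H in Y, forall x in S, (H :^ x)%G \in Y] &
      [forall H in Y, forall K in Y, connect (restr Y) H K]].

Lemma coreP (Y : {set {group gT}}) : reflect [/\ Y != set0,
    forall H, H \in Y -> vtx H,
    forall H x, H \in Y -> x \in S -> (H :^ x)%G \in Y &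
    forall H K, H \in Y -> K \in Y -> connect (restr Y) H K] (core Y).
Proof.
apply: (iffP and4P) => [[Y0 vY cY kY]|[Y0 vY cY kY]]; split => //.
- exact/forall_inP.
- by move=> H x HY xS; move/forall_inP/(_ _ HY)/forall_inP: cY; apply.
- by move=> H K HY KY; move/forall_inP/(_ _ HY)/forall_inP: kY; apply.
- exact/forall_inP.
- by apply/forall_inP => H HY; apply/forall_inP => x; apply: cY.
- by apply/forall_inP => H HY; apply/forall_inP => x; apply: kY.
Qed.

Lemma core_exists : exists Y, core Y.
Proof.
have [D hD] := exists_hinge; have [M0 [M1 [m0 m1 ne p0 p1]]] := hinge_maximals hD.
have csym := sym_connect_sym hinge_adj_sym.
have conn_conj H K x : x \in S -> connect hinge_adj H K ->
    connect hinge_adj (H :^ x)%G (K :^ x)%G.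
  move=> xS /connectP[p]; elim: p H => [|H' p IH] H /=; first by move=> _ ->.
  by case/andP=> /(hinge_adj_conj xS)/connect1 c /IH{}IH /IH; apply: connect_trans.
have c01 : connect hinge_adj M0 M1.
  apply: (@connect_trans _ _ D); apply: connect1; rewrite /hinge_adj /hinge_below.
    by rewrite hD m0 p0 orbT.
  by rewrite hD m1 p1.
have fixM M x : x \in M -> (M :^ x)%G = M.
  by move=> xM; apply: val_inj; apply: conjGid.
(* The stabiliser of the component of [M0]. It contains the distinct maximal subgroups [M0] and
   [M1], so it is not proper. *)
pose St := [set x in S | connect hinge_adj M0 (M0 :^ x)%G].
have gSt : group_set St.
  apply/group_setP; split; first by rewrite inE group1 fixM ?group1 ?connect0.
  move=> x y; rewrite !inE => /andP[xS cx] /andP[yS cy]; rewrite groupM //=.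
  by apply: connect_trans cy _; rewrite conjG_M; apply: conn_conj.
have sM0 : M0 \subset St.
  apply/subsetP => x xM; rewrite inE fixM // connect0 andbT.
  exact: (subsetP (proper_sub (maxgroupp m0))).
have sM1 : M1 \subset St.
  apply/subsetP => x xM; have xS : x \in S.
    exact: (subsetP (proper_sub (maxgroupp m1))).
  rewrite inE xS; apply: (connect_trans c01).
  by rewrite csym -(fixM M1 x xM); exact: (conn_conj M0 M1 x xS c01).
have StS : St = S.
  apply/eqP; rewrite eqEproper; apply/andP; split; first by apply/subsetP => x /setIdP[].
  apply/negP => pSt; case/negP: ne; apply/eqP.
  have e0 := @maximal_eq M0 (Group gSt) m0 pSt sM0.
  by have e1 := @maximal_eq M1 (Group gSt) m1 pSt sM1; rewrite -e0 -e1.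
exists [set H | connect hinge_adj M0 H].
apply/coreP; split.
- by apply/set0Pn; exists M0; rewrite inE.
- move=> H; rewrite inE => /connectP[p]; case/lastP: p => [|p K] /=.
    by move=> _ ->; rewrite /vtx m0 orbT.
  by rewrite rcons_path last_rcons => /andP[_ /hinge_adj_vtx/andP[_ v]] ->.
- move=> H x; rewrite !inE => c xS; apply: connect_trans (conn_conj _ _ x xS c).
  by move: xS; rewrite -{1}StS inE => /andP[].
move=> H K; rewrite !inE => cH cK.
have c : connect hinge_adj H K by rewrite csym in cH; apply: connect_trans cH cK.
case/connectP: c => p; elim: p H cH => [|H' p IH] H cH /=; first by move=> _ ->.
case/andP=> a; have cH' := connect_trans cH (connect1 a).
move/(IH _ cH'){IH} => IH /IH; apply: connect_trans; apply: connect1.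
by rewrite /restr !inE cH cH'.
Qed.

(** [H] is not normal, so [Y] contains another conjugate of [H] and a path leading to it. *)
Lemma core_nbr (Y : {set {group gT}}) H : core Y -> H \in Y ->
  exists2 K, K \in Y & hinge_adj H K.
Proof.
case/coreP=> _ vY cY kY HY; have vH := vY H HY.
have [x xS ne] := not_normal (vtx_neq1 vH) (vtx_proper vH).
have /connectP[[|K p] /=] := kY H _ HY (cY H x HY xS); first by move=> _ e; rewrite e eqxx in ne.
by case/andP=> /and3P[_ KY a] _ _; exists K.
Qed.

Lemma hinge_conjE H x : x \in S -> hinge (H :^ x)%G = hinge H.
Proof.
move=> xS; apply/idP/idP; last exact: hinge_conj.
move/(hinge_conj (groupVr xS)); congr hinge; apply: val_inj; exact: conjsgK.
Qed.

Definition deg (Y : {set {group gT}}) H := #|[set K in Y | hinge_adj H K]|.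

Lemma core_deg_conj (Y : {set {group gT}}) H x : core Y -> x \in S ->
  deg Y (H :^ x)%G = deg Y H.
Proof.
case/coreP=> _ _ cY _; rewrite /deg.
have le K y : y \in S -> deg Y K <= deg Y (K :^ y)%G.
  move=> yS; have inj : injective (fun K => (K :^ y)%G) 
    by apply: (can_inj (g := fun K => (K :^ y^-1)%G)) => L; apply: conjG_K.
  rewrite /deg -(card_imset _ inj); apply/subset_leq_card/subsetP => M /imsetP[L].
  by rewrite inE => /andP[LY a] ->; rewrite inE cY // hinge_adj_conj.
move=> xS; apply/eqP; rewrite eqn_leq (le _ x) // andbT.
by rewrite -{2}(conjG_K H x); apply: (le _ x^-1); rewrite groupV.
Qed.

(** In a minimal core, a vertex of degree at most 1 would have a whole orbit [O] of such vertices,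
    and [Y :\: O] would be a smaller core. *)
Lemma core_min : exists Y, core Y /\ forall H, H \in Y -> 1 < deg Y H.
Proof.
have [Y /minsetP[cY minY]] := ex_minset core_exists.
have /coreP[Y0 vY jY kY] := cY.
exists Y; split=> // v vY'; rewrite ltnNge; apply/negP => deg1.
pose O := [set (v :^ x)%G | x in S].
have uniq u K K' : u \in O -> K \in Y -> K' \in Y -> hinge_adj u K -> hinge_adj u K' -> K = K'.
  case/imsetP=> x xS -> KY KY' a a'.
  rewrite -(core_deg_conj v cY xS) in deg1.
  by move/card_le1_eqP: deg1; apply; rewrite inE ?KY ?KY'.
have hO u : u \in O -> hinge u = hinge v by case/imsetP=> x xS ->; apply: hinge_conjE.
have nOO u u' : u \in O -> u' \in O -> ~~ hinge_adj u u'.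
  by move=> /hO h /hO h'; apply/negP => /hinge_adj_type; rewrite h h'; case: (hinge v).
have vO : v \in O by apply/imsetP; exists 1; rewrite ?group1 //; apply: val_inj; rewrite /= conjsg1.
have JO u x : u \in O -> x \in S -> (u :^ x)%G \in O.
  case/imsetP=> y yS -> xS; apply/imsetP; exists (y * x); first exact: groupM.
  by rewrite conjG_M.
(* A retraction of [Y] onto [Y :\: O] sending each leaf to its only neighbour. That neighbour is
   outside [O], because adjacent vertices have different types; so paths retract to paths. *)
pose r u := if u \in O then odflt u [pick K | (K \in Y) && hinge_adj u K] else u.
have rO u K : u \in O -> K \in Y -> hinge_adj u K -> r u = K.
  move=> uO KY a; rewrite /r uO; case: pickP => [K' /andP[KY' a'] | /(_ K)] /=.
    exact: uniq a' a.
  by rewrite KY a.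
have rN u : u \notin O -> r u = u by rewrite /r => /negPf->.
have : core (Y :\: O).
  apply/coreP; split.
  - have [K KY a] := core_nbr cY vY'; apply/set0Pn; exists K; rewrite inE KY andbT.
    by apply: contraL a => KO; apply: nOO.
  - by move=> H /setDP[/vY].
  - move=> H x /setDP[HY nHO] xS; rewrite inE jY // andbT.
    by apply: contra nHO => /JO/(_ (groupVr xS)); rewrite conjG_K.
  move=> H K /setDP[HY nHO] /setDP[KY nKO].
  rewrite -(rN H) // -(rN K) //; have /connectP[p] := kY H K HY KY.
  elim: p {nHO nKO HY KY} H => [|H' p IH] H /=; first by move=> _ ->; apply: connect0.
  case/andP=> /and3P[HY HY' a] /IH{}IH /IH; apply: connect_trans.
  have [HO|HO] := boolP (H \in O).
    have nHO' : H' \notin O by apply: contraL a; apply: nOO.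
    by rewrite (rO H H') // rN // connect0.
  have [HO'|HO'] := boolP (H' \in O).
    by rewrite (rN H) // (rO H' H) ?connect0 // hinge_adj_sym.
  by rewrite !rN //; apply: connect1; rewrite /restr !inE HO HO' HY HY'.
move/minY => /(_ (subsetDl _ _))/setP/(_ v).
by rewrite inE vO vY'.
Qed.

(** The kernel of the action on [Z] is normal in [S], and it is not [S] because no vertex is a
    normal subgroup. *)
Lemma conj_faithful (Z : {set {group gT}}) x :
  Z != set0 -> (forall H, H \in Z -> vtx H) ->
  (forall H y, H \in Z -> y \in S -> (H :^ y)%G \in Z) ->
  x \in S -> (forall H, H \in Z -> (H :^ x)%G = H) -> x = 1.
Proof.
case/set0Pn=> H0 HZ0 vZ jZ xS fx.
pose K := [set y in S | [forall H in Z, (H :^ y)%G == H]].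
have KP y : reflect (y \in S /\ forall H, H \in Z -> (H :^ y)%G = H) (y \in K).
  rewrite inE; apply: (iffP andP) => [[yS /forall_inP f]|[yS f]]; split=> //.
    by move=> H /f/eqP.
  by apply/forall_inP => H /f/eqP.
have gK : group_set K.
  apply/group_setP; split; first by apply/KP; split=> // H _; apply: val_inj; apply: conjsg1.
  move=> y z /KP[yS fy] /KP[zS fz]; apply/KP; split=> [|H HZ]; first exact: groupM.
  by rewrite conjG_M fy ?fz.
have nK : Group gK <| S.
  apply/andP; split; first by apply/subsetP => y /KP[].
  apply/subsetP => y yS; rewrite inE; apply/subsetP => _ /imsetP[z /KP[zS fz] ->].
  apply/KP; split; first by rewrite groupJ.
  by move=> H HZ; rewrite conjgE !conjG_M fz ?conjG_KV // jZ ?groupV.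
have [/= K1|/= KS] := normal_simple nK.
  by apply/set1gP; rewrite -K1; apply/KP.
have vH := vZ _ HZ0; have [y yS] := not_normal (vtx_neq1 vH) (vtx_proper vH).
have : y \in K by rewrite KS.
by case/KP=> _ /(_ _ HZ0) ->; rewrite eqxx.
Qed.

(** If all degrees were 2, a non-trivial element of a hinge [D] below [M] would fix the adjacent
    vertices [D] and [M], hence all of [Y], against faithfulness. *)
Lemma core_branching (Y : {set {group gT}}) : core Y -> (forall H, H \in Y -> 1 < deg Y H) ->
  exists2 H, H \in Y & 2 < deg Y H.
Proof.
move=> cY deg2; case: (boolP [exists H in Y, 2 < deg Y H]) => [/exists_inP //|/exists_inPn deg3].
exfalso.
have {deg2 deg3} deg2 H : H \in Y -> deg Y H = 2.
  by move=> HY; apply/eqP; rewrite eqn_leq deg2 // andbT leqNgt; apply: deg3.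
have /coreP[/set0Pn[H HY] vY jY kY] := cY.
have [D [M [DY MY bDM]]] : exists D M, [/\ D \in Y, M \in Y & hinge_below D M].
  by have [K KY /orP[b|b]] := core_nbr cY HY; [exists H, K | exists K, H].
have /and3P[hD mM pDM] := bDM.
have [x xD x1] : exists2 x, x \in D & x != 1 by apply/trivgPn/hinge_neq1.
have xS : x \in S by apply: (subsetP (proper_sub (hinge_proper hD))).
have step u w K : u \in Y -> w \in Y -> K \in Y -> hinge_adj u w -> hinge_adj u K ->
    (u :^ x)%G = u -> (w :^ x)%G = w -> (K :^ x)%G = K.
  move=> uY wY KY aw aK fu fw; have [->//|ne] := eqVneq K w.
  have := deg2 u uY; rewrite /deg (cardsD1 w) inE wY aw /= => -[/eqP/cards1P[z zE]].
  have zP L : L \in Y -> hinge_adj u L -> L != w -> L = z.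
    by move=> LY aL nL; apply/set1P; rewrite -zE !inE nL LY.
  rewrite [RHS]zP //; apply: zP; first exact: jY.
    by rewrite -fu hinge_adj_conj.
  by apply: contra ne => /eqP e; rewrite -(conjG_K K x) e -{1}fw conjG_K.
have fixD : (D :^ x)%G = D by apply: val_inj; apply: conjGid.
have fixM : (M :^ x)%G = M.
  by apply: val_inj; apply: conjGid; apply: (subsetP (proper_sub pDM)).
case/eqP: x1; apply: (conj_faithful (Z := Y)) => //; first by apply/set0Pn; exists H.
(* Fixing a vertex together with its neighbours is the property that [step] propagates along
   edges. *)
pose good u := (u :^ x)%G = u /\ forall K, K \in Y -> hinge_adj u K -> (K :^ x)%G = K.
have gD : good D.
  by split=> // K KY aK; apply: (step D M K); rewrite // /hinge_adj bDM.
suff all_good K : K \in Y -> good K by move=> K /all_good[].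
move=> KY; have /connectP[p] := kY D K DY KY.
elim: p D gD {bDM hD pDM DY fixD xD} => [|L p IH] D gD /=; first by move=> _ ->.
case/andP=> /and3P[DY LY a]; apply: IH; case: gD => fD /(_ L LY a) fL.
by split=> // N NY aN; apply: (step L D N); rewrite // hinge_adj_sym.
Qed.

Definition core_edges (Y : {set {group gT}}) :=
  [set p : {group gT} * {group gT} | [&& p.1 \in Y, p.2 \in Y & hinge_below p.1 p.2]].

Lemma sum_deg (Y : {set {group gT}}) : \sum_(H in Y) deg Y H = (2 * #|core_edges Y|)%N.
Proof.
transitivity (\sum_H \sum_K ([&& H \in Y, K \in Y & hinge_below H K] +
                             [&& H \in Y, K \in Y & hinge_below K H])).
  rewrite big_mkcond; apply: eq_bigr => H _; rewrite /deg -sum1_card big_mkcond /=.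
  have [HY|_] := boolP (H \in Y); last by rewrite big1.
  apply: eq_bigr => K _; rewrite inE; have [KY|//] := boolP (K \in Y).
  rewrite /hinge_adj /=; have [/and3P[hH mK _]|_] := boolP (hinge_below H K); last by case: hinge_below.
  rewrite /hinge_below; suff -> : hinge K = false by [].
  by apply/negP => /hinge_not_maximal; rewrite mK.
under eq_bigr do rewrite big_split; rewrite big_split /= mul2n -addnn.
have e : \sum_H \sum_K [&& H \in Y, K \in Y & hinge_below H K] = #|core_edges Y|.
  rewrite pair_bigA -sum1_card big_mkcond [RHS]big_mkcond /=.
  by apply: eq_bigr => p _; rewrite inE; case: ifP.
congr (_ + _) => //; rewrite exchange_big -e; apply: eq_bigr => H _.
by apply: eq_bigr => K _; rewrite andbCA.
Qed.

Lemma simple_core_bound : exists2 Y, core Y & forall b, (#|core_edges Y| <= #|Y| + b)%N ->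
  (#|S| <= (2 * b) ^ (2 * b))%N.
Proof.
have [Y [cY deg2]] := core_min; exists Y => // b leE.
have /coreP[Y0 vY jY kY] := cY.
have [v vY' deg3] := core_branching cY deg2.
pose O := [set (v :^ x)%G | x in S].
have sOY : O \subset Y by apply/subsetP => _ /imsetP[x xS ->]; apply: jY.
have vO : v \in O by apply/imsetP; exists 1; rewrite ?group1 //; apply: val_inj; rewrite /= conjsg1.
have JO u x : u \in O -> x \in S -> (u :^ x)%G \in O.
  case/imsetP=> y yS -> xS; apply/imsetP; exists (y * x); first exact: groupM.
  by rewrite conjG_M.
have leO : (#|O| <= 2 * b)%N.
  (* All degrees are at least 2, and those on the orbit [O] at least 3. *)
  have : (2 * #|Y| + #|O| <= \sum_(H in Y) deg Y H)%N.
    have -> : #|O| = \sum_(H in Y) (H \in O).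
      rewrite -sum1_card big_mkcond [RHS]big_mkcond; apply: eq_bigr => H _.
      by case: (boolP (H \in O)) => [/(subsetP sOY)->|]; case: (H \in Y).
    rewrite mulnC -sum_nat_const.
    rewrite -big_split; apply: leq_sum => H HY /=; case: (boolP (H \in O)) => [HO|_].
      by case/imsetP: HO => x xS ->; rewrite core_deg_conj.
    by rewrite addn0 deg2.
  by rewrite sum_deg; lia.
have O_gt0 : 0 < #|O| by apply/card_gt0P; exists v.
apply: (@leq_trans (#|O| ^ #|O|)%N); last first.
  have b0 : (0 < 2 * b)%N by apply: leq_trans leO.
  by apply: (@leq_trans ((2 * b) ^ #|O|)%N); [rewrite leq_exp2r | rewrite leq_pexp2l].
pose T : finType := {u : {group gT} | u \in O}.
(* The action of [S] on [O]. For [x] in [S] the default of [insubd] never occurs, as [O] is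
   stable. *)
pose f x : {ffun T -> T} := [ffun u : T => insubd u (val u :^ x)%G].
have cardT : #|T| = #|O| by rewrite card_sig.
rewrite -cardT -card_ffun -(card_in_imset (f := f) (D := mem S)) ?max_card //.
move=> x y xS yS /ffunP fxy; apply/eqP; rewrite eq_mulgV1; apply/eqP.
apply: (conj_faithful (Z := O)) => //.
- by apply/set0Pn; exists v.
- by move=> u /(subsetP sOY)/vY.
- by rewrite groupM ?groupV.
move=> u uO; have := fxy (Sub u uO); rewrite !ffunE /= => /(congr1 val) /=.
rewrite !val_insubd /= !JO // => e.
by rewrite conjG_M e conjG_K.
Qed.

End SimpleGroup.

(** * Finitely many groups of bounded order *)

Section SmallGroups.
Local Open Scope group_scope.

(** Cayley's theorem by right multiplication, moved to ordinals so that the ambient group depends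
    only on [#|G|]. *)
Lemma isog_perm_ord (gT : finGroupType) (G : {group gT}) :
  exists H : {group 'S_#|G|}, G \isog H.
Proof.
pose m := #|G|; pose e (i : 'I_m) := enum_val i.
have eG i : e i \in G by apply: enum_valP.
pose r (x : gT) : 'I_m := enum_rank_in (group1 G) x.
have rK x : x \in G -> e (r x) = x by apply: enum_rankK_in.
have eK i : r (e i) = i by apply: enum_valK_in.
pose f x : {ffun 'I_m -> 'I_m} := [ffun i => r (e i * x)].
have f_inj x : x \in G -> injectiveb (f x).
  move=> xG; apply/injectiveP => i j; rewrite !ffunE => /(congr1 e).
  by rewrite !rK ?groupM // => /mulIg; apply: enum_val_inj.
pose p (x : gT) : 'S_m := insubd (perm_one _) (f x).
have pE x i : x \in G -> p x i = r (e i * x).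
  by move=> xG; rewrite -pvalE [pval _]val_insubd f_inj // ffunE.
have pM : {in G &, {morph p : x y / x * y}}.
  move=> x y xG yG; apply/permP => i.
  by rewrite permM !pE ?groupM // rK ?mulgA // groupM.
pose F := Morphism pM.
have injF : 'injm F.
  apply/injmP => x y xG yG /permP/(_ (r 1)); rewrite !pE // => /(congr1 e).
  by rewrite !rK ?groupM ?mul1g ?group1 // !rK ?group1 ?groupM // => /(@mulgI _ _ _ _).
by exists (F @* G)%G; apply: (sub_isog (subxx _) injF).
Qed.

(** The list consists of all subgroups of ['S_m] for [m <= b], with isomorphic repetitions. *)
Lemma finitely_many_small_groups (b : nat) : exists (n : nat) (rT : 'I_n -> finGroupType),
  forall (gT : finGroupType) (G : {group gT}), #|G| <= b -> exists i, G \isog [set: rT i].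
Proof.
pose I : finType := {m : 'I_b.+1 & {group 'S_m}}.
exists #|I|, (fun i => subg_of (tagged (enum_val i)) : finGroupType) => gT G leGb.
have [H isoGH] := isog_perm_ord G.
pose u : I := Tagged (fun m : 'I_b.+1 => {group 'S_m}) (H : {group 'S_(Ordinal (leGb : #|G| < b.+1))}).
exists (enum_rank u); rewrite enum_rankK.
exact: isog_trans isoGH (isog_subg H).
Qed.

End SmallGroups.

(** * The bipartite minor of the subgroup graph *)

Section Labels.
Local Open Scope group_scope.
Variables (gT : finGroupType) (S : {group gT}).
Hypothesis simS : simple S.
Hypothesis nabS : ~~ abelian S.
Variable Y : {set {group gT}}.
Hypothesis coreY : core S Y.
Implicit Types D H K M : {group gT}.

Lemma cover_up H K : H \proper K -> exists2 H', covered_by H H' & H' \subset K.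
Proof.
move=> pHK; pose P (H' : {group gT}) := (H \proper H') && (H' \subset K).
have P0 : P K by rewrite /P pHK /=.
case: (arg_minnP (fun H' : {group gT} => #|H'|) P0) => H' /andP[pHH' sH'K] minH'.
exists H' => //; rewrite /covered_by pHH' /=; apply/forallP => L; apply/negP => /andP[pHL pLH'].
have := minH' L; rewrite /P pHL (subset_trans (proper_sub pLH') sH'K) => /(_ isT).
by rewrite leqNgt proper_card.
Qed.

Lemma cover_down H K : H \proper K -> exists2 K', covered_by K' K & H \subset K'.
Proof.
move=> pHK; pose P (K' : {group gT}) := (K' \proper K) && (H \subset K').
have P0 : P H by rewrite /P pHK /=.
case: (arg_maxnP (fun K' : {group gT} => #|K'|) P0) => K' /andP[pK'K sHK'] maxK'.
exists K' => //; rewrite /covered_by pK'K /=; apply/forallP => L; apply/negP => /andP[pK'L pLK].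
have := maxK' L; rewrite /P pLK (subset_trans sHK' (proper_sub pK'L)) => /(_ isT) le.
by have := leq_trans (proper_card pK'L) le; rewrite ltnn.
Qed.

Lemma covered_by_proper H K : covered_by H K -> H \proper K. Proof. by case/andP. Qed.

Lemma covered_by_asym H K : covered_by H K -> ~~ covered_by K H.
Proof.
move=> /covered_by_proper p; apply/negP => /covered_by_proper q.
by have := proper_trans p q; rewrite properxx.
Qed.

Let vtxY H : H \in Y -> vtx S H. Proof. by case/coreP: coreY => _ + _ _; apply. Qed.

Definition above_hinge K := [exists D in Y, hinge S D && (D \proper K)].
Definition below_hinge K := [exists D in Y, hinge S D && (K \proper D)].

(* The branch sets of the contraction of the subgroup graph of [S], each one
   indexed by one of its members. *)
Definition branch (x K : {group gT}) :=
  [|| (x == S) && (K == S), [&& x \in Y, maximal x S, K \subset x & above_hinge K],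
      [&& x \in Y, hinge S x & K == x] | (x == 1%G) && below_hinge K].

Lemma branchP x K : reflect
  [\/ x = S /\ K = S,
      [/\ x \in Y, maximal x S, K \subset x & exists2 D, D \in Y & hinge S D /\ D \proper K],
      [/\ x \in Y, hinge S x & K = x] |
      x = 1%G /\ exists2 D, D \in Y & hinge S D /\ K \proper D] (branch x K).
Proof.
have ex_hinge (P : pred {group gT}) : reflect (exists2 D, D \in Y & hinge S D /\ P D)
    [exists D in Y, hinge S D && P D].
  apply: (iffP exists_inP) => -[D DY]; first by case/andP=> h p; exists D.
  by case=> h p; exists D => //; rewrite h.
apply: (iffP or4P) => -[].
- by case/andP=> /eqP -> /eqP ->; constructor 1.
- by case/and4P=> ? ? ? /ex_hinge ?; constructor 2.
- by case/and3P=> ? ? /eqP ->; constructor 3.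
- by case/andP=> /eqP -> /ex_hinge ?; constructor 4.
- by case=> -> ->; constructor 1; rewrite !eqxx.
- by case=> ? ? ? /ex_hinge ?; constructor 2; apply/and4P.
- by case=> ? ? ->; constructor 3; apply/and3P.
by case=> -> /ex_hinge ?; constructor 4; apply/andP.
Qed.

Let anti D D' : hinge S D -> hinge S D' -> D \proper D' -> False.
Proof. by move=> h h'; apply/negP/(hinge_anti h h'). Qed.

Let hprop D : hinge S D -> D \proper S. Proof. exact: hinge_proper. Qed.

(** Incomparability of hinges separates the subgroups strictly above a hinge, the hinges and the
    subgroups strictly below one; [hinge_unique] separates the branch sets of two maximal
    subgroups. *)
Lemma branch_uniq x x' K : branch x K -> branch x' K -> x = x'.
Proof.
have no_max M : maximal M S -> S \subset M -> False.
  by move=> /maxgroupp /proper_subn/negP.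
case/branchP=> [[-> ->]|[xY mx sKx [D DY [hD pDK]]]|[xY hx ->]|[-> [D DY [hD pKD]]]];
  case/branchP=> [[-> KS]|[xY' mx' sKx' [D' DY' [hD' pDK']]]|[xY' hx' KE]|[-> [D' DY' [hD' pKD']]]] //.
all: try by [].
all: try by case: (no_max x').
all: try by case: (no_max x mx); rewrite -KS.
all: try by have := hprop hx'; rewrite -?KE properxx.
all: try by have := proper_trans pKD' (hprop hD'); rewrite ?KS properxx.
all: try by have := proper_trans pKD (hprop hD); rewrite ?KS properxx.
all: try by apply: (hinge_unique hD pDK mx mx' sKx sKx').
all: try by case: (anti hD hx'); rewrite -?KE.
all: try by case: (anti hx' hD); rewrite -?KE.
all: try by case: (anti hD' hx).
all: try by case: (anti hx hD').
all: try by case: (anti hD hD'); apply: proper_trans pDK pKD'.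
all: try by case: (anti hD' hD); apply: proper_trans pDK' pKD.
all: try by have := hprop hx; rewrite ?KS properxx.
Qed.

Lemma max_above_hinge M : M \in Y -> maximal M S -> exists2 D, D \in Y & hinge S D /\ D \proper M.
Proof.
move=> MY mM; have [D DY /orP[/and3P[hM _ _]|/and3P[hD _ pDM]]] := core_nbr simS nabS coreY MY.
  by have := hinge_not_maximal hM; rewrite mM.
by exists D.
Qed.

Lemma branch_sub x K : branch x K -> K \subset S.
Proof.
case/branchP=> [[_ ->]|[_ mx sKx _]|[_ hx ->]|[_ [D _ [hD pKD]]]] //.
- exact: subset_trans sKx (proper_sub (maxgroupp mx)).
- exact: proper_sub (hprop hx).
exact: proper_sub (proper_trans pKD (hprop hD)).
Qed.

Let ltn_subS a b c n : a < b -> b <= c -> c - a < n.+1 -> c - b < n.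
Proof. lia. Qed.

(* Every member of a branch set is joined to its index by a chain of covers. *)
Lemma branch_chain (C : Type) (f : {group gT} -> C) x :
  (forall H K, covered_by H K -> branch x H -> branch x K -> f H = f K) ->
  forall K, branch x K -> f K = f x.
Proof.
move=> fE K bK; case/branchP: (bK) => [[-> ->]|[xY mx sKx [D DY [hD pDK]]]|[_ _ ->]|[xE [D DY [hD pKD]]]] //.
  have [n] := ubnP (#|x| - #|K|); elim: n K bK sKx pDK => // n IH K bK sKx pDK lt.
  have [-> //|ne] := eqVneq K x.
  have pKx : K \proper x by rewrite properEneq sKx andbT; apply: contra ne => /eqP e; apply/eqP/val_inj.
  have [K' cK sK'x] := cover_up pKx; have pKK' := covered_by_proper cK.
  have pDK' := proper_trans pDK pKK'.
  have bK' : branch x K' by apply/branchP; constructor 2; split=> //; exists D.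
  rewrite (fE _ _ cK bK bK'); apply: (IH K' bK' sK'x pDK').
  exact: ltn_subS (proper_card pKK') (subset_leq_card sK'x) lt.
have [n] := ubnP #|K|; elim: n K bK pKD => // n IH K bK pKD lt.
have [K1|ne] := eqVneq (K : {set gT}) 1.
  by congr f; rewrite xE; apply: val_inj.
have p1K : 1%G \proper K by rewrite proper1G.
have [K' cK _] := cover_down p1K; have pK'K := covered_by_proper cK.
have pK'D := proper_trans pK'K pKD.
have bK' : branch x K' by apply/branchP; constructor 4; split=> //; exists D.
rewrite -(fE _ _ cK bK' bK); apply: (IH K' bK' pK'D).
exact: leq_trans (proper_card pK'K) lt.
Qed.

Definition labels := S |: (1%G |: Y).

(** The first end is the bottom or a maximal subgroup, the second a hinge or the top; this is the
    bipartition coloured by [upper]. *)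
Definition is_edge (p : {group gT} * {group gT}) :=
  [|| [&& p.1 == 1%G, p.2 \in Y & hinge S p.2],
      [&& p.2 \in Y, p.1 \in Y & hinge_below S p.2 p.1] |
      [&& p.1 \in Y, maximal p.1 S & p.2 == S]].

Definition upper x := (x == S) || hinge S x.

Let hingeS : hinge S S = false.
Proof. by apply/negP => /hprop; rewrite properxx. Qed.

Let oneS : (1%G == S) = false.
Proof.
apply/eqP => e; case/simpleP: simS => /eqP; rewrite -e //.
Qed.

Let hinge1 : hinge S 1%G = false.
Proof. by apply/negP => /hinge_neq1; rewrite eqxx. Qed.

Let maxS M : maximal M S -> M == S = false.
Proof. by move/maxgroupp=> p; apply/eqP => e; rewrite e properxx in p. Qed.

Lemma edge_sides p : is_edge p -> [/\ p.1 \in labels, p.2 \in labels, upper p.1 = false & upper p.2].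
Proof.
case: p => x y; rewrite /is_edge /labels /upper /= !inE.
case/or3P => [/and3P[/eqP -> yY hy]|/and3P[yY xY /and3P[hy mx _]]|/and3P[xY mx /eqP ->]].
- by rewrite eqxx yY hy oneS hinge1 !orbT.
- rewrite yY xY hy maxS // !orbT; split=> //; apply/negP => hx.
  by have := hinge_not_maximal hx; rewrite mx.
rewrite eqxx xY maxS // !orbT; split=> //; apply/negP => hx.
by have := hinge_not_maximal hx; rewrite mx.
Qed.

(** The bottom reaches a hinge through a maximal subgroup of the hinge, a hinge reaches a maximal
    subgroup by the first cover towards it, and a maximal subgroup is covered by [S]. *)
Lemma edge_cover p : is_edge p -> exists H K, covered_by H K /\
  ((branch p.1 H /\ branch p.2 K) \/ (branch p.2 H /\ branch p.1 K)).
Proof.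
case: p => x y; rewrite /is_edge /=.
case/or3P => [/and3P[/eqP -> yY hy]|/and3P[yY xY /and3P[hy mx pyx]]|/and3P[xY mx /eqP ->]].
- have p1y : 1%G \proper y by rewrite proper1G; exact: hinge_neq1 hy.
  have [K cK _] := cover_down p1y; exists K, y; split=> //; left; split; apply/branchP.
    by constructor 4; split=> //; exists y => //; split=> //; exact: covered_by_proper.
  by constructor 3.
- have [K cK sKx] := cover_up pyx; exists y, K; split=> //; right; split; apply/branchP.
    by constructor 3.
  by constructor 2; split=> //; exists y => //; split=> //; exact: covered_by_proper.
exists x, S; split; last first.
  left; split; apply/branchP; last by constructor 1.
  by constructor 2; split=> //; apply: max_above_hinge.
have pxS := maxgroupp mx; rewrite /covered_by pxS; apply/forallP => K; apply/negP => /andP[pxK pKS].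
by have := maximal_eq mx pKS (proper_sub pxK) => e; rewrite e properxx in pxK.
Qed.

Lemma card_labels : #|labels| <= #|Y| + 2.
Proof.
rewrite /labels !cardsU1; apply: leq_trans (leq_add (leq_b1 _) (leq_add (leq_b1 _) (leqnn _))) _.
by rewrite addnA addnC.
Qed.

(** Besides the edges of [Y], each of its hinges is joined to the bottom and each of its maximal
    subgroups to the top. *)
Lemma card_edges : #|Y| + #|core_edges S Y| <= #|[set p | is_edge p]|.
Proof.
pose A := [set ((1%G : {group gT}), D) | D in [set D in Y | hinge S D]].
pose C := [set (M, S) | M in [set M in Y | ~~ hinge S M]].
pose swap (p : {group gT} * {group gT}) := (p.2, p.1).
pose B := swap @: core_edges S Y.
have cA : #|A| = #|[set D in Y | hinge S D]| by apply: card_imset => x y [].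
have cC : #|C| = #|[set M in Y | ~~ hinge S M]| by apply: card_imset => x y [].
have cB : #|B| = #|core_edges S Y| by apply: card_imset => -[a b] [c d] [-> ->].
have cY : #|Y| = #|A| + #|C|.
  rewrite cA cC -(cardsID [set D | hinge S D] Y); congr (_ + _); apply: eq_card => D; rewrite !inE //.
  exact: andbC.
have maxY M : M \in Y -> ~~ hinge S M -> maximal M S by move=> /vtxY /orP[->|].
have AC : [disjoint A & C].
  rewrite -setI_eq0; apply/eqP/setP => -[a b]; rewrite in_setI in_set0; apply/negP => /andP[].
  by case/imsetP=> D; rewrite inE => /andP[_ hD] [_ ->] /imsetP[M _ [_ e]]; rewrite e hingeS in hD.
have AB : [disjoint A & B].
  rewrite -setI_eq0; apply/eqP/setP => -[a b]; rewrite in_setI in_set0; apply/negP => /andP[].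
  case/imsetP=> D _ [-> _] /imsetP[[c d]]; rewrite inE /= => /and3P[_ _ /and3P[_ mM _]] [e _].
  by have := maximal_neq1 simS nabS mM; rewrite -e eqxx.
have BC : [disjoint B & C].
  rewrite -setI_eq0; apply/eqP/setP => -[a b]; rewrite in_setI in_set0; apply/negP => /andP[].
  case/imsetP=> -[c d]; rewrite inE /= => /and3P[_ _ /and3P[hD _ _]] [_ ->] /imsetP[M _ [_ e]].
  by rewrite e hingeS in hD.
have -> : #|Y| + #|core_edges S Y| = #|A :|: B :|: C|.
  have dis : [disjoint A :|: B & C] by rewrite -setI_eq0 setIUl setU_eq0 !setI_eq0 AC.
  have /eqP -> : #|A :|: B :|: C| == #|A :|: B| + #|C| by rewrite (leq_card_setU _ C).2.
  have /eqP -> : #|A :|: B| == #|A| + #|B| by rewrite (leq_card_setU A B).2.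
  by rewrite cY cB addnAC.
apply/subset_leq_card/subsetP => p; rewrite !inE -orbA => /or3P[] /imsetP[].
- by move=> D; rewrite inE => /andP[DY hD] ->; rewrite /is_edge /= eqxx DY hD.
- by move=> [a b]; rewrite inE /= => h ->; rewrite /is_edge /= h orbT.
by move=> M; rewrite inE => /andP[MY nh] ->; rewrite /is_edge /= MY maxY // eqxx !orbT.
Qed.

End Labels.

(* Imported only here: the classical sets shadow lemmas on finite sets. *)
From mathcomp Require Import all_classical all_reals all_analysis.

(** * Traces of connected and of compact sets on fine grids *)

Section Fineness.
Import Order.TTheory GRing.Theory Num.Theory.
Import numFieldNormedType.Exports.
Local Open Scope ring_scope.
Local Open Scope classical_set_scope.
Variables (R : realType) (g : nat).
Local Notation pt := (R * R * R)%type.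

Section Continuity.
Variable T : topologicalType.
Implicit Types f h : T -> R.

Lemma contD f h : continuous f -> continuous h -> continuous (fun z => f z + h z).
Proof. by move=> cf ch z; apply: cvgD; [exact: cf | exact: ch]. Qed.

Lemma contN f : continuous f -> continuous (fun z => - f z).
Proof. by move=> cf z; apply: cvgN; exact: cf. Qed.

Lemma contM f h : continuous f -> continuous h -> continuous (fun z => f z * h z).
Proof. by move=> cf ch z; apply: cvgM; [exact: cf | exact: ch]. Qed.

Lemma contX f : continuous f -> continuous (fun z => f z ^+ 2).
Proof. by move=> cf z; apply: (@cvg_comp _ _ _ f (fun x => x ^+ 2) _ _ _ (cf z)); apply: exprn_continuous. Qed.

Lemma cont_cst (a : R) : continuous (fun _ : T => a).
Proof. by move=> z; exact: cvg_cst. Qed.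

Lemma cont_prod (I : Type) (r : seq I) (F : I -> T -> R) :
  (forall i, continuous (F i)) -> continuous (fun z => \prod_(i <- r) F i z).
Proof.
move=> cF; elim: r => [|i r IH].
  by rewrite (_ : (fun z => _) = fun=> 1); [exact: cont_cst | apply/funext => z; rewrite big_nil].
rewrite (_ : (fun z => _) = fun z => F i z * \prod_(j <- r) F j z); first exact: contM.
by apply/funext => z; rewrite big_cons.
Qed.

Lemma cont_max0 f : continuous f -> continuous (fun z => Num.max 0 (f z)).
Proof.
move=> cf z; exact: (@continuous_max R T (fun=> 0) f z (@cst_continuous _ _ _ _) (cf z)).
Qed.

Lemma cont_sqrt f : continuous f -> continuous (fun z => Num.sqrt (f z)).
Proof. by move=> cf z; apply: (@cvg_comp _ _ _ f Num.sqrt _ _ _ (cf z)); apply: sqrt_continuous. Qed.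

Lemma cont_signed s f : continuous f -> continuous (fun z => signed s (f z)).
Proof. by move=> cf; case: s => //=; apply: contN. Qed.

Lemma cont_floor f : continuous f -> continuous (fun z => floor g (f z)).
Proof.
move=> cf; apply: (@continuous_big _ _ +%R 0 xpredT (@add_continuous _) T (index_enum 'I_g)
  (fun k z => Num.max 0 (cap k (f z)))) => k _.
apply: cont_max0; apply: contD; [exact: cont_cst | apply: contN; apply: contX].
by apply: contD => //; exact: cont_cst.
Qed.

Lemma cont_height f : continuous f -> continuous (fun z => height g (f z)).
Proof.
move=> cf; apply: contD; last by apply: contN; exact: cont_floor.
by apply: contD; [exact: cont_cst | apply: contN; exact: contX].
Qed.

Lemma cont_wall f h : continuous f -> continuous h -> continuous (fun z => wall g (f z) (h z)).
Proof.
move=> cf ch; apply: contM.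
  apply: contD; last exact: contN.
  by apply: contD; [exact: cont_cst | apply: contN; exact: contX].
apply: (cont_prod (F := fun (i : 'I_g) z => (f z - (3 * i)%:R) ^+ 2 + h z - 1)) => k.
apply: contD; last exact: cont_cst.
by apply: contD => //; apply: contX; apply: contD => //; exact: cont_cst.
Qed.

End Continuity.

Lemma chart_continuous s t : continuous (fun z : R * R => chart g s t z.1 z.2).
Proof.
have c1 : continuous (fun z : R * R => z.1) by move=> z; exact: cvg_fst.
have c2 : continuous (fun z : R * R => z.2) by move=> z; exact: cvg_snd.
have cl : continuous (fun z : R * R => level g z.1 z.2).
  by apply: contD; [exact: cont_floor | apply: contM => //; exact: cont_height].
have cy := cont_signed (s := s) (cont_sqrt cl).
have cz := cont_signed (s := t) (cont_sqrt (cont_wall c1 cl)).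
by move=> z; exact: (cvg_pair (cvg_pair (c1 z) (cy z)) (cz z)).
Qed.

Lemma disjoint_compacts_apart (A A' : set pt) : compact A -> closed A' -> A `&` A' = set0 ->
  \forall e \near 0^'+, forall p p', A p -> A' p' -> ~ ball p e p'.
Proof.
move=> cA clA' dis.
have /compact_near_coveringP cov := cA.
have H := cov R (0 : R)^'+ (fun e p => forall p', A' p' -> ~ ball p e p') _.
have : \forall e \near 0^'+, A `<=` (fun p => forall p', A' p' -> ~ ball p e p').
  apply: H => p Ap.
  have nA'p : ~ A' p by move=> A'p; have : (A `&` A') p by []; rewrite dis.
  have : nbhs p (~` A') by apply: open_nbhs_nbhs; split=> //; apply: closed_openC.
  rewrite -nbhs_ballE => -[d /= d0 sub].
  exists (ball p (d / 2), [set e : R | e < d / 2]); first split => /=.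
  - by apply: nbhsx_ballx; rewrite divr_gt0.
  - by apply: nbhs_right_lt; rewrite divr_gt0.
  move=> [q e] /= [pq ed] p' A'p' qp'; apply: (sub p') => //.
  by apply: ball_split pq _; apply: le_ball qp'; apply: ltW.
by apply: filterS => e sub p p' Ap; apply: sub.
Qed.

Definition domain : set (R * R) := `[- rad R g, rad R g] `*` `[0, 1].

Lemma domain_compact : compact domain.
Proof. by apply: compact_setX; apply: segment_compact. Qed.

(** Uniform continuity on the compact rectangle [domain], stated for the mesh of the grid. *)
Lemma chart_unif_continuous (e : R) : 0 < e -> \forall n \near \oo, forall s t (z z' : R * R),
  domain z -> `|z.1 - z'.1| <= n.+1%:R^-1 -> `|z.2 - z'.2| <= n.+1%:R^-1 ->
  ball (chart g s t z.1 z.2) e (chart g s t z'.1 z'.2).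
Proof.
move=> e0; have unif s t : \forall n \near \oo, forall (z z' : R * R),
  domain z -> `|z.1 - z'.1| <= n.+1%:R^-1 -> `|z.2 - z'.2| <= n.+1%:R^-1 ->
  ball (chart g s t z.1 z.2) e (chart g s t z'.1 z'.2).
  have /compact_near_coveringP cov := domain_compact.
  have H := cov nat \oo (fun n (z : R * R) => forall z' : R * R,
    `|z.1 - z'.1| <= n.+1%:R^-1 -> `|z.2 - z'.2| <= n.+1%:R^-1 ->
    ball (chart g s t z.1 z.2) e (chart g s t z'.1 z'.2)) _.
  have : \forall n \near \oo, domain `<=` (fun z => forall z' : R * R,
      `|z.1 - z'.1| <= n.+1%:R^-1 -> `|z.2 - z'.2| <= n.+1%:R^-1 ->
      ball (chart g s t z.1 z.2) e (chart g s t z'.1 z'.2)).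
    apply: H => z0 _; have e2 : 0 < e / 2 by rewrite divr_gt0.
    have : nbhs z0 ((fun z : R * R => chart g s t z.1 z.2) @^-1` ball (chart g s t z0.1 z0.2) (e / 2)).
      exact: (chart_continuous (nbhsx_ballx _ _ e2)).
    rewrite -nbhs_ballE => -[d /= d0 sub].
    have d2 : 0 < d / 2 by rewrite divr_gt0.
    exists (ball z0 (d / 2), [set n : nat | n.+1%:R^-1 < d / 2]); first split => /=.
    - exact: nbhsx_ballx.
    - exact: (near_infty_natSinv_lt (PosNum d2)).
    move=> [z n] /= [zz0 nd] z' h1 h2.
    have hz : ball z0 d z.
      by apply: le_ball zz0; rewrite ler_pdivrMr // ler_peMr // ?ltW //; lra.
    have hz' : ball z0 d z'.
      apply: ball_split zz0 _; split; rewrite /ball /=; exact: le_lt_trans nd.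
    apply: (@ball_splitr _ _ (chart g s t z0.1 z0.2)); [exact: (sub z hz) | exact: (sub z' hz')].
  by apply: filterS => n cov' z z' dz; apply: cov'.
near=> n => s t; case: s t => -[]; near: n; exact: unif.
Unshelve. all: by end_near. Qed.

Local Notation cell n' := ('I_((6 * g + 2) * n'.+1).-1.+1 * 'I_n'.+1 * bool * bool)%type.

Lemma in_cell_closed n' (f : cell n') :
  closed (in_cell (R := R) f).
Proof.
case: f => [[[i j] s] t]; set X := in_cell _.
have -> : X = (fun z : R * R => chart g s t z.1 z.2) @`
    (`[xs R g n' i, xs R g n' i.+1] `*` `[vs R n' j, vs R n' j.+1]).
  apply/seteqP; split=> [p [x [v [hx hv ->]]]|p [[x v] /= [hx hv] <-]].
    by exists (x, v) => //=; split; rewrite /= in_itv.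
  by exists x, v; move: hx hv; rewrite /= !in_itv.
apply: compact_closed; first exact: norm_hausdorff.
apply: continuous_compact; first by apply: continuous_subspaceT; exact: chart_continuous.
by apply: compact_setX; apply: segment_compact.
Qed.

(* The vertices of the cells that meet [A]. *)
Definition trace n' (A : set pt) : set pt := [set u |
  exists (f : cell n') a b p,
  [/\ in_cell f p, A p & u = corner R f a b]].

Local Notation src n' := (@dart_src R g n').
Local Notation tgt n' := (@dart_tgt R g n').

(** [phi] takes a single value on the corners of a cell meeting [A], and cells sharing a point of
    [A] share a corner, hence that value. The cells with value [c] and the other cells would cut [A]
    into two disjoint closed pieces. *)
Lemma trace_connected n' (A : set pt) (phi : pt -> 'F_2) :
  connected A -> (forall p, A p -> exists f : cell n', in_cell f p) ->
  (forall d, trace n' A (src n' d) -> trace n' A (tgt n' d) -> phi (src n' d) = phi (tgt n' d)) ->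
  forall u u', trace n' A u -> trace n' A u' -> phi u = phi u'.
Proof.
move=> cA covA phiA.
have corner_eq (f : cell n') p a b : in_cell f p -> A p -> phi (corner R f a b) = phi (corner R f false false).
  move=> fp Ap; have T a' b' : trace n' A (corner R f a' b') by exists f, a', b', p.
  have step v h : phi (corner R f (v && h) (~~ v && h)) = phi (corner R f (v ==> h) (v || h)).
    have [e1 e2] := dart_corner R f v h; rewrite -e1 -e2; apply: phiA; rewrite ?e1 ?e2; exact: T.
  have s1 := step false false; have s2 := step false true; have s3 := step true false.
  case: a b => -[].
  - by rewrite -s2 -s3.
  - by rewrite -s1.
  - by rewrite -s3.
  - by [].
have point_eq (f f' : cell n') p : in_cell f p -> in_cell f' p -> A p ->
    phi (corner R f false false) = phi (corner R f' false false).
  move=> fp f'p Ap; have [a [b [a' [b' e]]]] := in_cell_share fp f'p.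
  by rewrite -(corner_eq f p a b fp Ap) e (corner_eq f' p a' b' f'p Ap).
move=> u u' [f [a [b [p [fp Ap ->]]]]] [f' [a' [b' [p' [f'p' Ap' ->]]]]].
rewrite (corner_eq f p a b fp Ap) (corner_eq f' p' a' b' f'p' Ap').
set c := phi (corner R f _ _).
pose K (P : pred 'F_2) := \bigcup_(h in [set h : cell n' | P (phi (corner R h false false))])
  in_cell (R := R) h.
have clK P : closed (K P).
  by apply: closed_bigcup => [|h _]; [exact: finite_finset | exact: in_cell_closed].
have BA : A `&` K (pred1 c) = A.
  apply: cA.
  - by exists p; split=> //; exists f => //=; rewrite eqxx.
  - exists (~` K (predC1 c)); first exact: closed_openC.
    apply/seteqP; split=> q [Aq]; last first.
      move=> nK; have [h hq] := covA q Aq; split=> //; exists h => //=.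
      by apply/negPn/negP => ne; apply: nK; exists h.
    move=> [h /= /eqP hc hq]; split=> // -[h' /= /eqP ne h'q]; apply: ne.
    by rewrite -hc; apply: point_eq h'q hq Aq.
  - by exists (K (pred1 c)).
have : (A `&` K (pred1 c)) p' by rewrite BA.
by case=> _ [h /= /eqP <- hp']; apply: point_eq hp' f'p' Ap'.
Qed.

(** On a fine grid every corner of a cell is within half of the gap between the two sets from each
    point of the cell, so no vertex can belong to both traces. *)
Lemma trace_disjoint (A A' : set pt) : compact A -> closed A' -> A `&` A' = set0 ->
  \forall n \near \oo, trace n A `&` trace n A' = set0.
Proof.
move=> cA clA' dis; have apart := disjoint_compacts_apart cA clA' dis.
have [e e0 he] : exists2 e : R, 0 < e & forall p p', A p -> A' p' -> ~ ball p e p'.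
  have : \forall e \near (0 : R)^'+, 0 < e /\ forall p p', A p -> A' p' -> ~ ball p e p'.
    near=> e; split; [by near: e; apply: nbhs_right_gt | by near: e].
  by move/filter_ex => [e []]; exists e.
have e2 : 0 < e / 2 by rewrite divr_gt0.
have := chart_unif_continuous e2; apply: filterS => n unif.
have close u (f : cell n) a b p : in_cell (R := R) f p -> u = corner R f a b -> ball p (e / 2) u.
  case: f => [[[i j] s] t] [x [v [hx hv ->]]] ->; rewrite /corner /pos.
  have le1 (w w0 : R) k (q : bool) : k%:R / n.+1%:R - w0 <= w <= k.+1%:R / n.+1%:R - w0 ->
      `|w - ((k + q)%:R / n.+1%:R - w0)| <= n.+1%:R^-1.
    have i0 : 0 < n.+1%:R^-1 :> R by rewrite invr_gt0.
    have kE : k.+1%:R / n.+1%:R = k%:R / n.+1%:R + n.+1%:R^-1 :> R.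
      by rewrite -[k.+1]addn1 natrD mulrDl mul1r.
    move: kE i0; case: q; rewrite ?addn1 ?addn0; move: (k.+1%:R / n.+1%:R : R) (k%:R / n.+1%:R : R) (n.+1%:R^-1 : R);
      by move=> c d I -> i0 /andP[h1 h2]; rewrite ler_norml; apply/andP; split; lra.
  have dom : domain (x, v).
    have iN : (i.+1 <= (6 * g + 2) * n.+1)%N.
      by apply: leq_trans (ltn_ord i) _; rewrite prednK // muln_gt0 addn_gt0 orbT.
    have /andP[x1 _] := @xs_range R g n i (ltnW iN); have /andP[_ x2] := @xs_range R g n i.+1 iN.
    have /andP[v1 _] := @vs_range R n j (ltnW (ltn_ord j)).
    have /andP[_ v2] := @vs_range R n j.+1 (ltn_ord j).
    by split; rewrite /= in_itv /=; lra.
  apply: (unif s t (x, v) (xs R g n (i + a), vs R n (j + b)) dom) => /=.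
    exact: le1.
  by have := le1 v 0 j b; rewrite !subr0; apply.
apply/seteqP; split=> // u [[f [a [b [p [fp Ap uE]]]]] [f' [a' [b' [p' [f'p' A'p' uE']]]]]].
apply: (he p p') => //; apply: (ball_splitl (close _ _ _ _ _ fp uE)).
exact: close f'p' uE'.
Unshelve. all: by end_near. Qed.

End Fineness.

(** * From a drawing to a minor of the grid *)

Section Drawing.
Import Order.TTheory GRing.Theory Num.Theory.
Import numFieldNormedType.Exports.
Local Open Scope ring_scope.
Local Open Scope classical_set_scope.
Variables (R : realType) (g : nat) (V : finType) (o : rel V).
Local Notation pt := (R * R * R)%type.
Hypothesis o_asym : forall x y, o x y -> ~~ o y x.
Let e x y := o x y || o y x.
Variables (pos : V -> pt) (arc : V -> V -> R -> pt).
Hypothesis draw : is_drawing e (orientable_surface R g) pos arc.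

Let e_irr x : e x x = false.
Proof. by apply/negP => /orP[] h; move: (o_asym h); rewrite h. Qed.

Let e_sym x y : e x y = e y x. Proof. by rewrite /e orbC. Qed.

(** Each arc is cut into thirds: the outer ones go to the stars of its ends, the middle one to the
    edge. When [x] and [y] are not adjacent the stub is a point, so that [star] can run over all
    [y]. *)
Definition stub x y : set pt := if e x y then arc x y @` `[0, 1 / 3] else [set pos x].
Definition star x : set pt := \bigcup_(y in [set: V]) stub x y.
Definition middle x y : set pt := arc x y @` `[1 / 3, 2 / 3].

Let third : 0 < (1 / 3 : R). Proof. by lra. Qed.

Lemma arc_within x y (a b : R) : e x y -> 0 <= a -> b <= 1 ->
  {within `[a, b], continuous (arc x y)}.
Proof.
move=> exy a0 b1; apply: continuous_subspaceW (arc_continuous draw exy).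
by move=> t /=; rewrite !in_itv /= => /andP[h1 h2]; apply/andP; split; lra.
Qed.

Lemma stub_pos x y : stub x y (pos x).
Proof.
rewrite /stub; case: ifP => // exy; exists 0; last exact: (arc_start draw exy).
by rewrite /= in_itv /=; lra.
Qed.

Lemma stub_compact x y : compact (stub x y).
Proof.
rewrite /stub; case: ifP => [exy|_]; last exact: compact_set1.
apply: continuous_compact; last exact: segment_compact.
by apply: arc_within exy _ _; lra.
Qed.

Lemma stub_connected x y : connected (stub x y).
Proof.
rewrite /stub; case: ifP => [exy|_]; last exact: connected1.
apply: connected_continuous_connected; first exact: segment_connected.
by apply: arc_within exy _ _; lra.
Qed.

Lemma middle_compact x y : e x y -> compact (middle x y).
Proof.
move=> exy; apply: continuous_compact; last exact: segment_compact.
by apply: arc_within exy _ _; lra.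
Qed.

Lemma middle_connected x y : e x y -> connected (middle x y).
Proof.
move=> exy; apply: connected_continuous_connected; first exact: segment_connected.
by apply: arc_within exy _ _; lra.
Qed.

Lemma star_pos x : star x (pos x).
Proof. by exists x => //; apply: stub_pos. Qed.

Lemma star_connected x : connected (star x).
Proof.
apply: bigcup_connected => [|y _]; last exact: stub_connected.
by exists (pos x) => y _; apply: stub_pos.
Qed.

Lemma stubP x y p : stub x y p -> p = pos x \/ e x y /\ exists2 t, 0 < t <= 1 / 3 & p = arc x y t.
Proof.
rewrite /stub; case: ifP => [exy|_ ->]; last by left.
case=> t /=; rewrite in_itv /= => /andP[]; rewrite le_eqVlt => /orP[/eqP <- _ <-|t0 t1 <-].
  by left; exact: (arc_start draw exy).
by right; split=> //; exists t; rewrite ?t0.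
Qed.

Lemma middleP x y p : middle x y p -> exists2 t, 1 / 3 <= t <= 2 / 3 & p = arc x y t.
Proof. by case=> t /=; rewrite in_itv /= => ht <-; exists t. Qed.

Lemma stub_disjoint x y x' y' : x != x' -> stub x y `&` stub x' y' = set0.
Proof.
move=> ne; apply/seteqP; split=> // p [/stubP[->|[exy [t ht ->]]] /stubP[pE|[exy' [t' ht' pE]]]].
- by move/eqP: ne => /(_ (pos_inj draw pE)).
- have /(_ x) := @arc_avoids_vertices _ _ _ _ _ _ draw x' y' _ t' exy'.
  by apply => //; lra.
- have /(_ x') := @arc_avoids_vertices _ _ _ _ _ _ draw x y _ t exy.
  by apply => //; lra.
have [||[xx _]|[xy yx]] := @arc_no_crossing _ _ _ _ _ _ draw x y x' y' t t' exy exy' _ _ pE; try by lra.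
  by rewrite xx eqxx in ne.
(* The stubs come from opposite ends of one arc, and [t = 1 - t'] fails since both parameters are at
   most [1 / 3]. *)
subst x' y'; have := @arc_rev _ _ _ _ _ _ draw x y t' exy.
rewrite -pE => /(_ _)/(@arc_inj _ _ _ _ _ _ draw x y exy) => H.
have : t = 1 - t' by apply: H; rewrite ?in_itv /=; lra.
by lra.
Qed.

Lemma middle_stub_disjoint x y z w : e x y -> z != x -> z != y ->
  middle x y `&` stub z w = set0.
Proof.
move=> exy zx zy; apply/seteqP; split=> // p [/middleP[t ht ->] /stubP[pE|[ezw [t' ht' pE]]]].
  have /(_ z) := @arc_avoids_vertices _ _ _ _ _ _ draw x y _ t exy.
  by apply => //; lra.
have [||[xx _]|[xy yx]] := @arc_no_crossing _ _ _ _ _ _ draw x y z w t t' exy ezw _ _ pE; try by lra.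
  by rewrite xx eqxx in zx.
by rewrite yx eqxx in zy.
Qed.

Lemma middle_disjoint x y x' y' : o x y -> o x' y' -> (x, y) != (x', y') ->
  middle x y `&` middle x' y' = set0.
Proof.
move=> oxy oxy' ne; apply/seteqP; split=> // p [/middleP[t ht ->] /middleP[t' ht' pE]].
have exy : e x y by rewrite /e oxy.
have exy' : e x' y' by rewrite /e oxy'.
have [||[xx yy]|[xy yx]] := @arc_no_crossing _ _ _ _ _ _ draw x y x' y' t t' exy exy' _ _ pE; try by lra.
  by rewrite xx yy eqxx in ne.
by move: (o_asym oxy'); rewrite -xy -yx oxy.
Qed.

Lemma surface_cover n p : orientable_surface R g p -> exists f : 'I_((6 * g + 2) * n.+1).-1.+1 * 'I_n.+1 * bool * bool, in_cell f p.
Proof.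
case: p => [[x y] z] /chart_cover[s [t [v [hx hv ->]]]].
exact: grid_cover.
Qed.

Lemma stub_on x y p : stub x y p -> orientable_surface R g p.
Proof.
case/stubP => [->|[exy [t ht ->]]]; first exact: (pos_on draw).
by apply: (arc_on draw exy); lra.
Qed.

Lemma middle_on x y p : e x y -> middle x y p -> orientable_surface R g p.
Proof. by move=> exy /middleP[t ht ->]; apply: (arc_on draw exy); lra. Qed.

Lemma traceU (I : Type) (P : set I) (F : I -> set pt) n u :
  trace g n (\bigcup_(i in P) F i) u -> exists2 i, P i & trace g n (F i) u.
Proof.
by case=> f [a [b [p [fp [i Pi Fp] uE]]]]; exists i => //; exists f, a, b, p.
Qed.

(** Only finitely many pairs of disjoint compact sets are to be separated, so one grid serves for
    all. *)
Lemma fine_grid : exists n,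
  [/\ forall x x', x != x' -> trace g n (star x) `&` trace g n (star x') = set0,
   forall x y z, o x y -> z != x -> z != y -> trace g n (middle x y) `&` trace g n (star z) = set0 &
   forall x y x' y', o x y -> o x' y' -> (x, y) != (x', y') ->
     trace g n (middle x y) `&` trace g n (middle x' y') = set0].
Proof.
have cl (A : set pt) : compact A -> closed A by apply: compact_closed; exact: norm_hausdorff.
have F1 : \forall n \near \oo, forall q : V * V * V * V,
    q.1.1.1 != q.1.1.2 -> trace g n (stub q.1.1.1 q.1.2) `&` trace g n (stub q.1.1.2 q.2) = set0.
  apply: filter_forall => -[[[x x'] y] y'] /=.
  have [->|ne] := eqVneq x x'; first by near=> n.
  have := trace_disjoint g (@stub_compact x y) (cl _ (@stub_compact x' y')) (stub_disjoint y y' ne).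
  by apply: filterS.
have F2 : \forall n \near \oo, forall q : V * V * V * V,
    o q.1.1.1 q.1.1.2 -> q.1.2 != q.1.1.1 -> q.1.2 != q.1.1.2 ->
    trace g n (middle q.1.1.1 q.1.1.2) `&` trace g n (stub q.1.2 q.2) = set0.
  apply: filter_forall => -[[[x y] z] w] /=.
  have [oxy|no] := boolP (o x y); last by near=> n.
  have [->|ne] := eqVneq z x; first by near=> n.
  have [->|ne'] := eqVneq z y; first by near=> n.
  have exy : e x y by rewrite /e oxy.
  have := trace_disjoint g (@middle_compact _ _ exy) (cl _ (@stub_compact z w)) (middle_stub_disjoint w exy ne ne').
  by apply: filterS.
have F3 : \forall n \near \oo, forall q : V * V * V * V,
    o q.1.1.1 q.1.1.2 -> o q.1.2 q.2 -> q.1.1 != (q.1.2, q.2) ->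
    trace g n (middle q.1.1.1 q.1.1.2) `&` trace g n (middle q.1.2 q.2) = set0.
  apply: filter_forall => -[[[x y] z] w] /=.
  have [oxy|no] := boolP (o x y); last by near=> n.
  have [ozw|no] := boolP (o z w); last by near=> n.
  have [_|ne] := eqVneq (x, y) (z, w); first by near=> n.
  have exy : e x y by rewrite /e oxy.
  have ezw : e z w by rewrite /e ozw.
  have := trace_disjoint g (@middle_compact _ _ exy) (cl _ (@middle_compact _ _ ezw)) (middle_disjoint oxy ozw ne).
  by apply: filterS.
have [n [[h1 h2] h3]] : exists n, ((forall q : V * V * V * V,
    q.1.1.1 != q.1.1.2 -> trace g n (stub q.1.1.1 q.1.2) `&` trace g n (stub q.1.1.2 q.2) = set0) /\
    (forall q : V * V * V * V,
    o q.1.1.1 q.1.1.2 -> q.1.2 != q.1.1.1 -> q.1.2 != q.1.1.2 ->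
    trace g n (middle q.1.1.1 q.1.1.2) `&` trace g n (stub q.1.2 q.2) = set0)) /\
    forall q : V * V * V * V,
    o q.1.1.1 q.1.1.2 -> o q.1.2 q.2 -> q.1.1 != (q.1.2, q.2) ->
    trace g n (middle q.1.1.1 q.1.1.2) `&` trace g n (middle q.1.2 q.2) = set0.
  by apply: (@filter_ex _ \oo); apply: filterI => //; apply: filterI.
exists n; split.
- move=> x x' ne; apply/seteqP; split=> // u [/traceU[y _ uy] /traceU[y' _ uy']].
  by have /seteqP[+ _] := h1 (x, x', y, y') ne; apply.
- move=> x y z oxy zx zy; apply/seteqP; split=> // u [um /traceU[w _ uw]].
  by have /seteqP[+ _] := h2 (x, y, z, w) oxy zx zy; apply.
by move=> x y x' y' oxy oxy' ne; apply: (h3 (x, y, x', y')).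
Unshelve. all: by end_near. Qed.

(** The branch set of [x] is the trace of its star together with, for each edge [o x y], the part of
    the trace of the middle reached from that star before the star of [y]. A dart leading from this
    branch set into the star of [y] represents the edge. *)
Lemma drawing_minor : exists n (B : pt -> option V),
  (forall v (phi : pt -> 'F_2),
     (forall d, B (@dart_src R g n d) = Some v -> B (@dart_tgt R g n d) = Some v ->
        phi (dart_src R d) = phi (dart_tgt R d)) ->
     forall u u', B u = Some v -> B u' = Some v -> phi u = phi u') /\
  forall x y, o x y -> exists d,
    (B (@dart_src R g n d) = Some x /\ B (@dart_tgt R g n d) = Some y) \/
    (B (@dart_src R g n d) = Some y /\ B (@dart_tgt R g n d) = Some x).
Proof.
have [n [D1 D2 D3]] := fine_grid.
pose W x := trace g n (star x); pose M x y := trace g n (middle x y).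
have {D1} D1 x x' u : W x u -> W x' u -> x = x'.
  move=> h h'; apply/eqP/negPn/negP => ne.
  by have /seteqP[+ _] := D1 _ _ ne; move/(_ u); apply.
have {D2} D2 x y z u : o x y -> M x y u -> W z u -> z = x \/ z = y.
  move=> oxy h h'; have [->|zx] := eqVneq z x; [by left|right].
  apply/eqP/negPn/negP => zy.
  by have /seteqP[+ _] := D2 _ _ _ oxy zx zy; move/(_ u); apply.
have {D3} D3 x y x' y' u : o x y -> o x' y' -> M x y u -> M x' y' u -> x = x' /\ y = y'.
  move=> oxy oxy' h h'; suff : (x, y) = (x', y') by case.
  apply/eqP/negPn/negP => ne.
  by have /seteqP[+ _] := D3 _ _ _ _ oxy oxy' ne; move/(_ u); apply.
pose src := @dart_src R g n; pose tgt := @dart_tgt R g n.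
pose adj u u' := exists d, (src d = u /\ tgt d = u') \/ (src d = u' /\ tgt d = u).
(* The points of the trace of the middle of [xy] reachable from the star of [x]
   before the star of [y]. *)
pose Q x y u := forall Z : set pt, (forall w, M x y w -> W x w -> Z w) ->
  (forall w w', adj w w' -> Z w -> M x y w -> M x y w' -> ~ W y w' -> Z w') -> Z u.
have o_neq x y : o x y -> x <> y by move=> oxy xy; have := o_asym oxy; rewrite xy -{1}xy oxy.
have QM x y u : Q x y u -> M x y u by move=> /(_ (M x y)); apply.
have Qn x y u : o x y -> Q x y u -> ~ W y u.
  move=> oxy /(_ (fun w => ~ W y w)); apply=> [w _ Ww Wyw|//].
  by apply: (o_neq _ _ oxy); apply: D1 Ww Wyw.
have Q0 x y u : M x y u -> W x u -> Q x y u by move=> Mu Wu Z Z0 _; apply: Z0.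
have Qs x y u u' : adj u u' -> Q x y u -> M x y u' -> ~ W y u' -> Q x y u'.
  by move=> a Qu Mu' nW Z Z0 Zs; apply: (Zs u u') => //; [apply: Qu | apply: QM].
pose mem x u := W x u \/ exists2 y, o x y & Q x y u.
have mem_uniq x x' u : mem x u -> mem x' u -> x = x'.
  move=> [Wu|[y oxy Qu]] [Wu'|[y' oxy' Qu']].
  - exact: D1 Wu Wu'.
  - have [//|xy'] := D2 _ _ _ _ oxy' (QM _ _ _ Qu') Wu.
    by case: (Qn _ _ _ oxy' Qu'); rewrite -xy'.
  - have [//|xy] := D2 _ _ _ _ oxy (QM _ _ _ Qu) Wu'.
    by case: (Qn _ _ _ oxy Qu); rewrite -xy.
  by have [] := D3 _ _ _ _ _ oxy oxy' (QM _ _ _ Qu) (QM _ _ _ Qu').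
pose B u := [pick x | `[< mem x u >]].
have BP x u : B u = Some x <-> mem x u.
  rewrite /B; case: pickP => [x' /asboolP mx'|nm].
    by split=> [[<-] //|mx]; congr Some; apply: mem_uniq mx' mx.
  by split=> // mx; have := nm x; rewrite (asboolT mx).
have covS x p : star x p -> exists f : 'I_((6 * g + 2) * n.+1).-1.+1 * 'I_n.+1 * bool * bool, in_cell f p.
  by case=> y _ /stub_on; apply: surface_cover.
have traceP (A : set pt) p : A p -> orientable_surface R g p ->
    exists f : 'I_((6 * g + 2) * n.+1).-1.+1 * 'I_n.+1 * bool * bool,
      forall A' : set pt, A' p -> trace g n A' (corner R f false false).
  by move=> _ /(surface_cover n)[f fp]; exists f => A' A'p; exists f, false, false, p.
exists n, B; split.
  move=> x phi phiB.
  have conn d : mem x (src d) -> mem x (tgt d) -> phi (src d) = phi (tgt d).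
    by move=> /BP h /BP h'; exact: (phiB d h h').
  have Wc u u' : W x u -> W x u' -> phi u = phi u'.
    apply: trace_connected; first exact: star_connected.
      exact: covS.
    by move=> d h h'; apply: conn; left.
  have [f fE] := traceP _ _ (star_pos x) (pos_on draw x).
  have W0 := fE _ (star_pos x); set c := corner R f _ _ in W0.
  suff all_c u : mem x u -> phi u = phi c by move=> u u' /BP/all_c -> /BP/all_c.
  case=> [Wu|[y oxy Qu]]; first exact: Wc.
  suff [] : Q x y u /\ phi u = phi c by [].
  apply: (Qu (fun u => Q x y u /\ phi u = phi c)) => [w Mw Ww|w w' a [Qw <-] Mw Mw' nW].
    by split; [exact: Q0 | exact: Wc].
  have Qw' : Q x y w' by apply: Qs a Qw Mw' nW.
  split=> //; have mw : mem x w by right; exists y.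
  have mw' : mem x w' by right; exists y.
  by case: a => d [[ew ew']|[ew' ew]]; [apply/esym|]; rewrite -ew -ew'; apply: conn; rewrite ?ew ?ew'.
move=> x y oxy; have exy : e x y by rewrite /e oxy.
have [[d hd]|nd] := pselect (exists d,
    (mem x (src d) /\ W y (tgt d)) \/ (W y (src d) /\ mem x (tgt d))).
  exists d; case: hd => [[mx Wy]|[Wy mx]]; [left|right]; split; apply/BP => //; by left.
(* Without such a dart, the reachable part is closed under all sides in the trace of the middle, so
   its indicator is constant there. Yet it contains a corner of a cell through the point of
   parameter [1 / 3] and misses one for [2 / 3]. *)
exfalso; pose phi u : 'F_2 := (`[< Q x y u >])%:R.
have half d u u' : u = src d /\ u' = tgt d \/ u = tgt d /\ u' = src d ->
    M x y u' -> Q x y u -> Q x y u'.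
  move=> uE Mu' Qu; apply: (Qs x y u u') => //.
    by exists d; case: uE => -[-> ->]; [left|right].
  move=> Wu'; apply: nd; exists d.
  have mu : mem x u by right; exists y.
  by case: uE => -[uE uE']; subst u u'; [left|right].
have phi_const : forall u u', M x y u -> M x y u' -> phi u = phi u'.
  apply: trace_connected; first exact: (middle_connected exy).
    by move=> p /(middle_on exy); apply: surface_cover.
  move=> d Ms Mt; rewrite /phi; congr (_%:R); congr (nat_of_bool _).
  apply/asbool_equiv_eq; split.
    by apply: (half d) => //; left.
  by apply: (half d) => //; right.
have Mx : middle x y (arc x y (1 / 3)) by exists (1 / 3) => //=; rewrite in_itv /=; lra.
have My : middle x y (arc x y (2 / 3)) by exists (2 / 3) => //=; rewrite in_itv /=; lra.
have Sx : star x (arc x y (1 / 3)).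
  by exists y => //; rewrite /stub exy; exists (1 / 3) => //=; rewrite in_itv /=; lra.
have Sy : star y (arc x y (2 / 3)).
  exists x => //; rewrite /stub e_sym exy; exists (1 / 3); first by rewrite /= in_itv /=; lra.
  rewrite (arc_rev draw exy); last by lra.
  by congr arc; lra.
have [f fE] := traceP _ _ Mx (middle_on exy Mx).
have [f' f'E] := traceP _ _ My (middle_on exy My).
have := phi_const _ _ (fE _ Mx) (f'E _ My).
have Qx : Q x y (corner R f false false) by apply: Q0; apply: fE.
have nQy : ~ Q x y (corner R f' false false) by move/(Qn _ _ _ oxy); apply; apply: f'E.
by rewrite /phi (asboolT Qx) (asboolF nQy).
Qed.

End Drawing.

(** * Bound on the order by the genus, and finiteness *)

Lemma simple_order_bound (R : realType) (g : nat) (gT : finGroupType) (S : {group gT}) :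
  simple S -> ~~ abelian S -> embeds_in_genus R (subgroup_graph (G := S)) g ->
  #|S| <= (2 * (24 * g + 12)) ^ (2 * (24 * g + 12)).
Proof.
move=> simS nabS [pos0 [arc draw]].
have [Y coreY boundY] := simple_core_bound simS nabS.
apply: boundY.
pose V := subgroup_vertex S.
pose o : rel V := fun H K => Defs.covered_by (val H) (val K).
have o_asym (H K : V) : o H K -> ~~ o K H by apply: covered_by_asym.
have [n [B [Bconn Bedge]]] := drawing_minor o_asym (draw : is_drawing (fun x y => o x y || o y x) _ _ _).
pose L : finType := {x : {group gT} | x \in labels S Y}.
pose E : finType := {p : {group gT} * {group gT} | is_edge S Y p}.
pose lab (K : V) : option L := [pick x : L | branch S Y (val x) (val K)].
have labP (x : L) (K : V) : lab K = Some x <-> branch S Y (val x) (val K).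
  rewrite /lab; case: pickP => [x' bx'|nb].
    by split=> [[<-] //|bx]; congr Some; apply: val_inj; apply: branch_uniq bx' bx.
  by split=> // bx; have := nb x; rewrite bx.
(* The composite of two contractions: grid points to subgroups, then subgroups to labels. *)
pose B' u := obind lab (B u).
have B'P u x : B' u = Some x <-> exists2 K, B u = Some K & branch S Y (val x) (val K).
  rewrite /B'; case: (B u) => [K|] /=; last by split=> // -[].
  by split=> [/labP|[_ [<-] /labP //]]; exists K.
have Bedge' (H K : {group gT}) : Defs.covered_by H K -> K \subset S -> exists (H' K' : V) d,
    [/\ val H' = H, val K' = K & (B (@dart_src R g n d) = Some H' /\ B (@dart_tgt R g n d) = Some K') \/
    (B (@dart_src R g n d) = Some K' /\ B (@dart_tgt R g n d) = Some H')].
  move=> cHK sKS; have sHS := fintype.subset_trans (fintype.proper_sub (covered_by_proper cHK)) sKS.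
  pose H' : V := Sub H sHS; pose K' : V := Sub K sKS.
  have [d dE] := Bedge H' K' cHK.
  by exists H', K', d.
have conn (x : L) (phi : R * R * R -> 'F_2) :
    (forall d, B' (@dart_src R g n d) = Some x -> B' (@dart_tgt R g n d) = Some x ->
       phi (@dart_src R g n d) = phi (@dart_tgt R g n d)) ->
    forall u v, B' u = Some x -> B' v = Some x -> phi u = phi v.
  move=> phiE.
  pose over (H : {group gT}) u := exists2 K : V, B u = Some K & val K = H.
  (* For [H] in the branch set of [x], [f H] is the value of [phi] on the grid points over [H],
     constant by [Bconn]; it is 0 if there are none. *)
  have /choice[f fE] (H : {group gT}) : exists c, branch S Y (val x) H -> forall u, over H u -> phi u = c.
    have [[u0 [K0 Bu0 K0H]]|no] := pselect (exists u, over H u); last first.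
      by exists 0%R => _ u ou; case: no; exists u.
    exists (phi u0) => bH u [K BuK KH].
    have KK0 : K = K0 by apply: val_inj; rewrite KH K0H.
    subst K0; apply: (Bconn K) => // d sK tK; apply: phiE; apply/B'P; exists K; rewrite ?KH //.
  (* A cover between two members is represented by a dart, along which [phi] does not change. *)
  have fx : forall K, branch S Y (val x) K -> f K = f (val x).
    apply: (branch_chain simS nabS coreY) => H K cHK bH bK.
    have [H' [K' [d [eH eK dE]]]] := Bedge' H K cHK (branch_sub bK).
    subst H K.
    have phid : phi (@dart_src R g n d) = phi (@dart_tgt R g n d).
      by apply: phiE; apply/B'P; case: dE => -[sE tE]; rewrite ?sE ?tE; eexists; eauto.
    case: dE => -[sE tE].
      rewrite -(fE _ bH (@dart_src R g n d)); last by exists H'.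
      by rewrite phid; apply: fE => //; exists K'.
    rewrite -(fE _ bH (@dart_tgt R g n d)); last by exists H'.
    by rewrite -phid; apply: fE => //; exists K'.
  have phi_f u : B' u = Some x -> phi u = f (val x).
    by move=> /B'P[K BuK bK]; rewrite -(fx _ bK); apply: fE => //; exists K.
  by move=> u v /phi_f -> /phi_f ->.
have srcL (e : E) : (val e).1 \in labels S Y by have [] := edge_sides simS (valP e).
have tgtL (e : E) : (val e).2 \in labels S Y by have [] := edge_sides simS (valP e).
pose src (e : E) : L := Sub (val e).1 (srcL e).
pose tgt (e : E) : L := Sub (val e).2 (tgtL e).
have [flip_src flip_tgt] : (forall d, @dart_src R g n (flip d) = dart_src R d) /\
    forall d, @dart_tgt R g n (flip d) = dart_tgt R d.
  by split=> d; have [] := flip_ends R d.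
have le : #|E| <= 2 * #|L| + 2 * #|{: 'I_(6 * g + 2) * bool}|.
  apply: (euler_bound (@flipK R g n) flip_src flip_tgt (@flip_loop R g n) (@dart_boundary R g n)
    (@periodsP R g n) conn (src := src) (tgt := tgt) (col := fun x => upper S (val x))).
  - by move=> e; have [] := edge_sides simS (valP e).
  - by move=> e; have [] := edge_sides simS (valP e).
  - move=> e e' /(congr1 val) /= e1 /(congr1 val) /= e2; apply: val_inj.
    by rewrite [LHS]surjective_pairing [RHS]surjective_pairing e1 e2.
  - move=> x; have [?|no] := pselect (exists u, B' u = Some x); first by left.
    by right => u Bu; apply: no; exists u.
  move=> e; have [H [K [cHK bHK]]] := edge_cover simS nabS coreY (valP e).
  have sKS : K \subset S by case: bHK => -[_ /branch_sub]; apply.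
  have [H' [K' [d [eH eK dE]]]] := Bedge' H K cHK sKS; subst H K.
  exists d; case: bHK => -[b1 b2]; case: dE => -[sE tE]; [left|right|right|left];
    split; apply/B'P; eexists; eauto.
move: le; rewrite card_prod card_bool card_ord.
have -> : #|E| = #|[set p | is_edge S Y p]| by rewrite card_sig cardsE.
have -> : #|L| = #|labels S Y| by rewrite card_sig.
(* There are at most [#|Y| + 2] labels and [12 * g + 4] periods, so the constant is
   [2 * 2 + 2 * (12 * g + 4) = 24 * g + 12]. *)
move=> le; have := leq_trans (card_edges simS nabS coreY) le; have := card_labels S Y.
by move: #|labels S Y| #|Y| #|core_edges S Y| => a b c; lia.
Qed.

Theorem theorem2 (R : realType) (k : nat) :
  exists (n : nat) (rT : 'I_n -> finGroupType),
    forall (gT : finGroupType) (S : {group gT}),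
      simple S -> ~~ abelian S ->
      (exists2 g : nat, is_genus R (subgroup_graph (G := S)) g & (g <= k)%N) ->
      exists i : 'I_n, S \isog [set: rT i].
Proof.
(* The bound increases with the genus, so its value at [k] serves for every genus up to [k]. *)
pose b m := (2 * (24 * m + 12)) ^ (2 * (24 * m + 12)).
have [n [rT small]] := finitely_many_small_groups (b k).
exists n, rT => gT S simS nabS [g [emb _] le_gk]; apply: small.
apply: leq_trans (simple_order_bound simS nabS emb) _.
have le_b : 2 * (24 * g + 12) <= 2 * (24 * k + 12) by rewrite leq_mul2l leq_add2r leq_mul2l le_gk.
apply: (@leq_trans ((2 * (24 * k + 12)) ^ (2 * (24 * g + 12)))).
  by rewrite leq_exp2r // muln_gt0 addn_gt0 orbT.
by rewrite leq_pexp2l // muln_gt0 addn_gt0 orbT.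
Qed.
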